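(* Let $T$ be a complete NATP theory and $M$ a model of $T$. Then (i) implies (ii), where: (i) There exists a pre-independence relation $\perp\!\!\!\perp$ which is stronger than heir-independence (that is, $a\perp\!\!\!\perp_M b$ implies that $\mathrm{tp}(a/Mb)$ is an heir over $M$) and satisfies monotonicity, full existence, the right chain condition for coheir Morley sequences, and strong right transitivity over $M$. (ii) For every tuple $b$, there exists a global coheir over $M$ (extending $\mathrm{tp}(b/M)$) which is a witness of Kim-dividing of $b$ over $M$. Thus Kim-forking is equivalent to Kim-dividing over $M$ (a formula Kim-forks over $M$ if and only if it Kim-divides over $M$).
   Context: $T$ is a complete first-order $\mathcal{L}$-theory with monster model $\mathbb{M}$; tuples and small sets live in $\mathbb{M}$ and models $M$ are small elementary submodels of $\mathbb{M}$. A global type is a complete type over $\mathbb{M}$. Formulas $\varphi(x,y)$ may use parameters from the base. ATP/NATP: An $\mathcal{L}$-formula $\varphi(x,y)$ has the antichain tree property (ATP) if there is $(a_\eta)_{\eta\in 2^{<\omega}}$ such that $\{\varphi(x,a_\eta)\}_{\eta\in X}$ is consistent for every antichain $X\subseteq 2^{<\omega}$ (a set of pairwise $\subseteq$-incomparable strings), and $\{\varphi(x,a_\eta),\varphi(x,a_\nu)\}$ is inconsistent whenever $\eta\subsetneq\nu$. $T$ is NATP if no formula has ATP. A global type $p(x)$ is invariant over $M$ if $\varphi(x,b)\in p\Leftrightarrow\varphi(x,b')\in p$ whenever $b\equiv_M b'$. A type is a coheir over $M$ if it is finitely satisfiable in $M$. A type $p(x)$ is an heir over $M$ if for all $\varphi(x,b)\in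 p(x)$ there is $m\in M$ with $\varphi(x,m)\in p(x)$. A sequence $(a_i)_{i<\omega}$ is generated by a global type $p$ over $M$ if $a_i\models p|_{Ma_{<i}}$ for all $i$; it is an invariant (respectively coheir) Morley sequence over $M$, in $\mathrm{tp}(a/M)$, if it is generated over $M$ by a global type $p\supseteq\mathrm{tp}(a/M)$ which is invariant over $M$ (respectively a coheir over $M$). $\varphi(x,a)$ Kim-divides over $M$ if there is an invariant Morley sequence $(a_i)_{i<\omega}$ in $\mathrm{tp}(a/M)$ such that $\{\varphi(x,a_i)\}_{i<\omega}$ is inconsistent. A formula or type Kim-forks over $M$ if it implies a finite disjunction of formulas with parameters, each of which Kim-divides over $M$. An $M$-indiscernible sequence $(b_i)_{i<\omega}$ is a witness of Kim-dividing of $b$ over $M$ if $b_0=b$ and $\{\varphi(x,b_i)\}_{i<\omega}$ is inconsistent whenever $\varphi(x,b)$ Kim-divides over $M$. A global $M$-invariant type $p(x)\supseteq\mathrm{tp}(b/M)$ is a witness of Kim-dividing of $b$ over $M$ if every invariant Morley sequence $(b_i)_{i<\omega}$ with $b_0=b$ generated by $p$ over $M$ is a witness of Kim-dividing of $b$ over $M$. A pre-independence relation is an automorphism-invariant ternary relation $a\perp\!\!\!\perp_c b$ on small sets (tuples). Properties over $M$: Monotonicity: if $aa'\perp\!\!\!\perp_M bb'$ then $a\perp\!\!\!\perp_M b$. Full existence: for all $a,b$ there is $a'\equiv_M a$ with $a'\perp\!\!\!\perp_M b$ (equivalently, there is $b'\equiv_M b$ with $a\perp\!\!\!\perp_M b'$).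 Right chain condition for coheir Morley sequences: if $a\perp\!\!\!\perp_M b$ and $(b_i)_{i<\omega}$ is a coheir Morley sequence over $M$ with $b_0=b$, then there is $a'\equiv_{Mb}a$ such that $a'\perp\!\!\!\perp_M (b_i)_{i<\omega}$ and $(b_i)_{i<\omega}$ is indiscernible over $Ma'$. Strong right transitivity: if $ab\perp\!\!\!\perp_M c$ and $a\perp\!\!\!\perp_M b$, then $a\perp\!\!\!\perp_M bc$. *)

(* Defs.v *)
From mathcomp Require Import all_boot.
From mathcomp Require Import boolp classical_sets functions cardinality.

Set Implicit Arguments.
Unset Strict Implicit.
Unset Printing Implicit Defensive.

Local Open Scope classical_set_scope.
Local Open Scope card_scope.

(** * First-order logic *)

Record language := Language {
  funs : Type;
  rels : Type;
  funs_ar : funs -> nat;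
  rels_ar : rels -> nat }.

Inductive term (L : language) (V : Type) : Type :=
| Var (v : V)
| App (f : funs L) (t : 'I_(funs_ar f) -> term L V).

(* [formula L V] has its free variables in [V]; a quantifier binds the
   variable [None : option V]. *)
Inductive formula (L : language) (V : Type) : Type :=
| Bot
| Eq (t u : term L V)
| Rel (r : rels L) (t : 'I_(rels_ar r) -> term L V)
| Imp (phi psi : formula L V)
| All (phi : formula L (option V)).

Arguments Bot {L V}.

Definition Not L (V : Type) (phi : formula L V) : formula L V := Imp phi Bot.

Fixpoint rename_term L (V W : Type) (f : V -> W) (t : term L V) : term L W :=
  match t with
  | Var v => Var L (f v)
  | App g ts => App (fun k => rename_term f (ts k))
  end.

Fixpoint rename L (V W : Type) (f : V -> W) (phi : formula L V) : formula L W :=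
  match phi with
  | Bot => Bot
  | Eq t u => Eq (rename_term f t) (rename_term f u)
  | Rel r ts => Rel (fun k => rename_term f (ts k))
  | Imp phi psi => Imp (rename f phi) (rename f psi)
  | All phi => All (rename (omap f) phi)
  end.

Record structure (L : language) := Structure {
  carrier :> Type;
  carrier_inhabited : inhabited carrier;
  fun_interp : forall f : funs L, ('I_(funs_ar f) -> carrier) -> carrier;
  rel_interp : forall r : rels L, ('I_(rels_ar r) -> carrier) -> Prop }.

Fixpoint eval L (U : structure L) (V : Type) (e : V -> U) (t : term L V) : U :=
  match t with
  | Var v => e v
  | App g ts => fun_interp (fun k => eval e (ts k))
  end.

Fixpoint sat L (U : structure L) (V : Type) (phi : formula L V) : (V -> U) -> Prop :=
  match phi with
  | Bot => fun _ => False
  | Eq t u => fun e => eval e t = eval e u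
  | Rel r ts => fun e => rel_interp (fun k => eval e (ts k))
  | Imp phi psi => fun e => sat phi e -> sat psi e
  | All phi => fun e => forall x : U, sat phi (oapp e x)
  end.

Definition theory (L : language) := set (formula L void).

Definition model_of L (U : structure L) (T : theory L) : Prop :=
  forall sigma, T sigma -> sat sigma (@of_void U).

Definition entails L (T : theory L) (sigma : formula L void) : Prop :=
  forall U : structure L, model_of U T -> sat sigma (@of_void U).

Definition complete_theory L (T : theory L) : Prop :=
  (exists U : structure L, model_of U T) /\
  (forall sigma, entails T sigma \/ entails T (Not sigma)).

Definition automorphism L (U : structure L) (s : U -> U) : Prop :=
  [/\ bijective s,
      forall (f : funs L) (t : 'I_(funs_ar f) -> U),
        s (fun_interp t) = fun_interp (s \o t)
    & forall (r : rels L) (t : 'I_(rels_ar r) -> U),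
        rel_interp (s \o t) <-> rel_interp t].

Definition fun_closed L (U : structure L) (M : set U) : Prop :=
  forall (f : funs L) (t : 'I_(funs_ar f) -> U),
    (forall k, M (t k)) -> M (fun_interp t).

Definition substructure L (U : structure L) (M : set U)
    (ne : inhabited {x | M x}) (cl : fun_closed M) : structure L :=
  @Structure L {x | M x} ne
    (fun f t => exist _ (fun_interp (fun k => sval (t k)))
                        (cl f _ (fun k => svalP (t k))))
    (fun r t => rel_interp (fun k => sval (t k))).

Definition elementary_sub L (U : structure L) (M : set U) : Prop :=
  exists (ne : inhabited {x | M x}) (cl : fun_closed M),
    forall n (phi : formula L 'I_n) (e : 'I_n -> substructure ne cl),
      sat phi e <-> sat phi (fun k => sval (e k)).

(** * Formulas with parameters and types *)

Section Types.
Context {L : language} {U : structure L}.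

(* Formulas in the tuple of variables [x = (x_i)_{i : I}] with parameters in
   [U]: the element [c : U] occurs as the variable [inr c]. *)
Definition pformula (I : Type) := formula L (I + U).

Definition glue {I J W : Type} (a : I -> W) (b : J -> W) (v : I + J) : W :=
  match v with inl i => a i | inr j => b j end.

Definition psat (I : Type) (a : I -> U) (phi : pformula I) : Prop :=
  sat phi (glue a id).

(* phi(x, b), for an L-formula phi(x, y) *)
Definition subst (I J : Type) (phi : formula L (I + J)) (b : J -> U) : pformula I :=
  rename (glue inl (inr \o b)) phi.

(* L(M)-formulas phi(x, y), and phi(x, b) for such formulas *)
Definition Mformula (M : set U) (I J : Type) :=
  formula L (I + (J + {c | M c})).

Definition inst (M : set U) (I J : Type) (phi : Mformula M I J) (b : J -> U) :
    pformula I :=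
  subst phi (glue b sval).

Definition forms_over (A : set U) {I : Type} : set (pformula I) :=
  [set subst phi sval | phi in [set: formula L (I + {c | A c})]].

Definition fin_satisfiable_in (A : set U) (I : Type) (p : set (pformula I)) : Prop :=
  forall n (phi : 'I_n -> pformula I), (forall k, p (phi k)) ->
    exists2 a : I -> U, (forall i, A (a i)) & (forall k, psat a (phi k)).

Definition consistent (I : Type) (p : set (pformula I)) : Prop :=
  fin_satisfiable_in setT p.

Definition realizes (I : Type) (a : I -> U) (p : set (pformula I)) : Prop :=
  forall phi, p phi -> psat a phi.

Definition tp (I : Type) (a : I -> U) (A : set U) : set (pformula I) :=
  [set phi | forms_over A phi /\ psat a phi].

Definition equiv (A : set U) (I : Type) (a a' : I -> U) : Prop := tp a A = tp a' A.

Definition global_type (I : Type) (p : set (pformula I)) : Prop :=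
  consistent p /\ forall phi, p phi \/ p (Not phi).

Definition invariant (M : set U) (I : Type) (p : set (pformula I)) : Prop :=
  forall n (phi : Mformula M I 'I_n) (b b' : 'I_n -> U),
    equiv M b b' -> (p (inst phi b) <-> p (inst phi b')).

Definition coheir (M : set U) (I : Type) (p : set (pformula I)) : Prop :=
  fin_satisfiable_in M p.

Definition heir (M : set U) (I : Type) (p : set (pformula I)) : Prop :=
  forall n (phi : Mformula M I 'I_n) (b : 'I_n -> U), p (inst phi b) ->
    exists2 m : 'I_n -> U, (forall k, M (m k)) & p (inst phi m).

(** * Morley sequences *)

Definition generated (M : set U) (I : Type) (p : set (pformula I))
    (s : nat -> I -> U) : Prop :=
  forall i : nat,
    realizes (s i)
      (p `&` forms_over (M `|` \bigcup_(j in [set j | (j < i)%N]) range (s j))).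

Definition indiscernible (A : set U) (I : Type) (s : nat -> I -> U) : Prop :=
  forall n (f g : 'I_n -> nat),
    (forall k l : 'I_n, (k < l)%N -> (f k < f l)%N) ->
    (forall k l : 'I_n, (k < l)%N -> (g k < g l)%N) ->
    equiv A (fun ki : 'I_n * I => s (f ki.1) ki.2)
            (fun ki : 'I_n * I => s (g ki.1) ki.2).

(* [s] is an invariant Morley sequence over [M] in tp(a/M) *)
Definition invariant_morley_in (M : set U) (I : Type) (a : I -> U)
    (s : nat -> I -> U) : Prop :=
  exists p : set (pformula I),
    [/\ global_type p, tp a M `<=` p, invariant M p & generated M p s].

(* [s] is a coheir Morley sequence over [M] in tp(a/M) *)
Definition coheir_morley_in (M : set U) (I : Type) (a : I -> U)
    (s : nat -> I -> U) : Prop :=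
  exists p : set (pformula I),
    [/\ global_type p, tp a M `<=` p, coheir M p & generated M p s].

(** * Kim-dividing *)

Definition kim_divides (M : set U) (I J : Type) (phi : Mformula M I J)
    (a : J -> U) : Prop :=
  exists2 s : nat -> J -> U, invariant_morley_in M a s &
    ~ consistent [set inst phi (s i) | i in [set: nat]].

Definition witness_seq (M : set U) (J : Type) (b : J -> U) (s : nat -> J -> U) : Prop :=
  [/\ indiscernible M s, s 0 = b &
      forall n (phi : Mformula M 'I_n J), kim_divides phi b ->
        ~ consistent [set inst phi (s i) | i in [set: nat]]].

Definition witness_type (M : set U) (J : Type) (b : J -> U)
    (p : set (pformula J)) : Prop :=
  [/\ global_type p, invariant M p, tp b M `<=` p &
      forall s : nat -> J -> U, s 0 = b -> generated M p s ->
        witness_seq M b s].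

(** * The antichain tree property *)

Definition antichain (X : set (seq bool)) : Prop :=
  forall eta nu, X eta -> X nu -> prefix eta nu -> eta = nu.

Definition ATP n m (phi : formula L ('I_n + 'I_m)) : Prop :=
  exists a : seq bool -> 'I_m -> U,
    (forall X, antichain X -> consistent [set subst phi (a eta) | eta in X]) /\
    (forall eta nu, prefix eta nu -> eta <> nu ->
       ~ consistent [set subst phi (a eta); subst phi (a nu)]).

End Types.

(* NATP of a complete theory, evaluated in its monster model [U]. *)
Definition NATP L (U : structure L) : Prop :=
  forall n m (phi : formula L ('I_n + 'I_m)), ~ ATP (U := U) phi.

(** * Monster models *)

(* "Small" means of cardinality < kappa, where kappa is the cardinal of the
   type [K]. *)
Definition small (K : Type) (I : Type) (A : set I) : Prop :=
  (A #<= [set: K]) /\ ~ ([set: K] #<= A).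

Definition strong_limit (K : Type) : Prop :=
  forall (I : Type) (A : set I), small K A -> small K [set B : set I | B `<=` A].

(* Every small consistent set of formulas in a small tuple of variables is
   realized. *)
Definition saturated (K : Type) L (U : structure L) : Prop :=
  forall (I : Type) (A : set U) (p : set (pformula I)),
    small K [set: I] -> small K A -> p `<=` forms_over A -> consistent p ->
    exists a : I -> U, realizes a p.

Definition strongly_homogeneous (K : Type) L (U : structure L) : Prop :=
  forall (I : Type) (a a' : I -> U), small K [set: I] -> equiv set0 a a' ->
    exists2 s : U -> U, automorphism s & forall i, s (a i) = a' i.

Record monster_model (K : Type) L (T : theory L) (U : structure L) : Prop := {
  monster_model_of : model_of U T;
  monster_uncountable : small K [set: nat];
  monster_strong_limit : strong_limit K;
  monster_small_funs : small K [set: funs L];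
  monster_small_rels : small K [set: rels L];
  monster_saturated : saturated K U;
  monster_homogeneous : strongly_homogeneous K U }.

Definition small_model (K : Type) L (U : structure L) (M : set U) : Prop :=
  small K M /\ elementary_sub M.

(** * Kim-forking *)

Definition kim_forks (K : Type) L (U : structure L) (M : set U) (I J : Type)
    (phi : Mformula M I J) (a : J -> U) : Prop :=
  exists (k : nat) (H : 'I_k -> Type) (psi : forall j, Mformula M I (H j))
         (c : forall j, H j -> U),
    [/\ forall j, small K [set: H j],
        forall j, kim_divides (psi j) (c j) &
        forall x : I -> U, psat x (inst phi a) ->
          exists j, psat x (inst (psi j) (c j))].

(** * Pre-independence relations *)

(* [ind A C B] is "A is independent from B over C".  A tuple is identified with
   its range, and the concatenation of two tuples with the union. *)
Definition ternary_relation (U : Type) := set U -> set U -> set U -> Prop.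

Definition pre_independence (K : Type) L (U : structure L)
    (ind : ternary_relation U) : Prop :=
  forall (s : U -> U) (A C B : set U), automorphism s ->
    small K A -> small K C -> small K B ->
    ind A C B -> ind (s @` A) (s @` C) (s @` B).

Definition stronger_than_heir (K : Type) L (U : structure L) (M : set U)
    (ind : ternary_relation U) : Prop :=
  forall (I : Type) (a : I -> U) (B : set U), small K [set: I] -> small K B ->
    ind (range a) M B -> heir M (tp a (M `|` B)).

Definition monotonicity (K : Type) L (U : structure L) (M : set U)
    (ind : ternary_relation U) : Prop :=
  forall A A' B B' : set U,
    small K A -> small K A' -> small K B -> small K B' ->
    ind (A `|` A') M (B `|` B') -> ind A M B.

Definition full_existence (K : Type) L (U : structure L) (M : set U)
    (ind : ternary_relation U) : Prop :=
  forall (I : Type) (a : I -> U) (B : set U), small K [set: I] -> small K B ->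
    exists2 a' : I -> U, equiv M a' a & ind (range a') M B.

Definition right_chain_condition (K : Type) L (U : structure L) (M : set U)
    (ind : ternary_relation U) : Prop :=
  forall (I J : Type) (a : I -> U) (b : J -> U) (s : nat -> J -> U),
    small K [set: I] -> small K [set: J] ->
    ind (range a) M (range b) -> coheir_morley_in M b s -> s 0 = b ->
    exists a' : I -> U,
      [/\ equiv (M `|` range b) a' a,
          ind (range a') M (\bigcup_i range (s i)) &
          indiscernible (M `|` range a') s].

Definition strong_right_transitivity (K : Type) L (U : structure L)
    (M : set U) (ind : ternary_relation U) : Prop :=
  forall A B C : set U, small K A -> small K B -> small K C ->
    ind (A `|` B) M C -> ind A M B -> ind A M (B `|` C).

(* Main.v *)
From Stdlib Require List.
From mathcomp Require Import all_boot.
From mathcomp Require Import boolp classical_sets functions cardinality filter.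
Require Import Defs.

(** The proof builds, in two situations, finite binary trees of tuples with two
    properties.  Antichains, read from left to right, are Morley sequences of one
    coheir [F] over [M] along which a formula is consistent; branches, read from the
    leaves to the root, are Morley sequences of an invariant type [q] along which the
    same formula is inconsistent.  Such trees of all heights contradict NATP
    ([no_utowers]).

    Branches are only known to be inconsistent when they have [k] nodes, whereas ATP
    asks for inconsistent pairs.  Suppose NATP and apply it to the conjunction of many
    copies of the formula, evaluated in parallel copies of the trees: antichains being
    consistent, some two comparable positions are jointly consistent in all the copies.
    As the type of a cone of these trees depends on its level only, trees can be cut
    into slices in each of which this pair of positions serves as a single node; the
    antichains of the new trees are consistent again, and branches are inconsistent
    from half as many nodes on ([double_towers]).  Iterating, single nodes become
    inconsistent, which is absurd ([no_towers]).

    The trees grow from the leaves.  Given a tree, take a second copy realizing the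
    same coheir over the first one, and put above both a root realizing [q] over them.

    In the first situation [q] is any invariant type witnessing that the formula
    Kim-divides.  The tuple with the new root still realizes a coheir, but the coheir
    of the root cannot be chosen.  Taking trees of maximal height for each coheir, and
    one root above copies of all of them, shows that trees of all heights exist for
    some coheir [F] ([utower_all_heights]).  Hence Kim-dividing over [M] is always
    witnessed by a coheir ([coheir_witness], [kim_divides_coheir]).

    In the second situation an independence relation as in the theorem is given.  A
    large small set [N] is made independent from a copy of [b]; since the relation
    implies heir-independence, the type of this copy over [N] is a coheir [F].  Let a
    formula Kim-divide, so that it is inconsistent along a coheir [q].  Trees with all
    nodes of type [F] and branches generated by [q] can be kept independent from [N]:
    strong right transitivity allows to duplicate a tree, and the right chain
    condition allows to add the root ([indep_tower]).  So the formula is inconsistent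
    along [F] too, and [F] is a witness ([ind_witness]).

    Finally let a formula imply a disjunction of Kim-dividing formulas.  The disjuncts
    Kim-divide when seen as formulas in the tuple of all parameters, because coheirs
    extend from a tuple to a longer one ([kim_divides_rename]); so they are
    inconsistent along the same Morley sequences of a witness, and by the pigeonhole
    principle the given formula is inconsistent along them ([forks_divides]). *)

Set Implicit Arguments.
Unset Strict Implicit.
Unset Printing Implicit Defensive.

Local Open Scope classical_set_scope.
Local Open Scope card_scope.

(** * Small sets *)

Lemma sval_inj (I : Type) (A : set I) : injective (@sval I A).
Proof. by move=> [x Ax] [y Ay] /= exy; apply: eq_exist. Qed.

Lemma card_leP_fun (I J : Type) (A : set I) (B : set J) :
  (A #<= B) <-> exists f : {x | A x} -> {y | B y}, injective f.
Proof.
split=> [/card_leP[f]|[f fI]].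
  have fI : injective f by move=> u v; apply: inj; rewrite inE.
  pose to_A (x : {x | A x}) : A := SigSub (mem_set (svalP x)).
  pose of_B (y : B) : {y | B y} := exist _ (val y) (set_mem (valP y)).
  exists (fun x => of_B (f (to_A x))) => x y /(congr1 sval)/val_inj/fI.
  by move=> /(congr1 val)/= /sval_inj.
apply/card_leP.
pose of_A (x : A) : {x | A x} := exist _ (val x) (set_mem (valP x)).
pose to_B (y : {y | B y}) : B := SigSub (mem_set (svalP y)).
have /injfunPex[g] : exists2 g : A -> B, set_fun setT setT g & set_inj setT g.
  exists (to_B \o f \o of_A) => // x y _ _ /(congr1 val)/= exy.
  have /fI/(congr1 sval)/= : f (of_A x) = f (of_A y) by apply: sval_inj.
  exact: val_inj.
by squash g.
Qed.

Lemma card_le_fun (I J : Type) (A : set I) (B : set J) (f : I -> J) :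
  (forall x, A x -> B (f x)) ->
  (forall x y, A x -> A y -> f x = f y -> x = y) -> A #<= B.
Proof.
move=> fAB fI; apply/card_leP_fun.
exists (fun x => exist _ (f (sval x)) (fAB _ (svalP x))).
move=> x y /(congr1 sval)/= /fI exy; apply: sval_inj.
by apply: exy; apply: svalP.
Qed.

Lemma card_leT_fun (I J : Type) (f : I -> J) :
  injective f -> [set: I] #<= [set: J].
Proof. by move=> fI; apply: (card_le_fun (f := f)) => // x y _ _ /fI. Qed.

Lemma card_leT_inj (I J : Type) :
  [set: I] #<= [set: J] -> exists f : I -> J, injective f.
Proof.
move=> /card_leP_fun[f fI]; pose in_T (x : I) := exist [set: I] x Logic.I.
exists (fun x => sval (f (in_T x))) => x y e.
by have /(congr1 sval) := fI _ _ (sval_inj e).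
Qed.

(** Zorn's lemma on the partial bijections. *)
Lemma card_le_total (I J : Type) :
  ([set: I] #<= [set: J]) \/ ([set: J] #<= [set: I]).
Proof.
pose matching (R : set (I * J)) := forall p q, R p -> R q ->
  (p.1 = q.1 <-> p.2 = q.2).
have [F matF totF|R [Rm Rmax]] := @Zorn_bigcup _ matching.
  move=> p q [X FX Xp] [Y FY Yq].
  by have [XY|YX] := totF _ _ FX FY; [apply: matF FY _ _ (XY _ Xp) Yq|
                                      apply: matF FX _ _ Xp (YX _ Yq)].
have [totR|/existsNP[x0 nx0]] := pselect (forall x, exists y, R (x, y)).
  left; have [f fR] := choice totR.
  apply: (card_leT_fun (f := f)) => x y exy.
  by apply/(Rm _ _ (fR x) (fR y)).
have [onR|/existsNP[y0 ny0]] := pselect (forall y, exists x, R (x, y)).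
  right; have [g gR] := choice onR.
  apply: (card_leT_fun (f := g)) => x y exy.
  by apply/(Rm _ _ (gR x) (gR y)).
case: (Rmax (R `|` [set (x0, y0)])).
  split=> [|sR]; first by move=> p Rp; left.
  by apply: nx0; exists y0; apply: sR; right.
move=> [a b] [c d] [Rp|[-> ->]] [Rq|[-> ->]] //=; first exact: Rm Rp Rq.
  split=> e; first by case: nx0; exists b; rewrite -e.
  by case: ny0; exists a; rewrite -e.
split=> e; first by case: nx0; exists d; rewrite e.
by case: ny0; exists c; rewrite e.
Qed.

Section Small.
Context {K : Type} (K_nat : small K [set: nat]) (K_lim : strong_limit K).

Local Notation Small I := (small K [set: I]).

Lemma small_le (I J : Type) (A : set I) (B : set J) :
  A #<= B -> small K B -> small K A.
Proof.
move=> AB [BK nKB]; split; first exact: card_le_trans AB BK.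
by move=> KA; apply: nKB; apply: card_le_trans KA AB.
Qed.

Lemma small_sub (I : Type) (A B : set I) : A `<=` B -> small K B -> small K A.
Proof. by move=> AB; apply: small_le; apply: subset_card_le. Qed.

Lemma small_inj (I J : Type) (f : I -> J) : injective f -> Small J -> Small I.
Proof. by move=> fI; apply: small_le; apply: (card_leT_fun fI). Qed.

Lemma small_range (I J : Type) (f : I -> J) : Small I -> small K (range f).
Proof. by apply: small_le; apply: card_image_le. Qed.

Lemma small_image (I J : Type) (f : I -> J) (A : set I) :
  small K A -> small K (f @` A).
Proof. by apply: small_le; apply: card_image_le. Qed.

Lemma small_sig (I : Type) (A : set I) : small K A -> Small {x | A x}.
Proof.
apply: small_le; apply: (card_le_fun (f := sval)) => [x _|x y _ _ e].
  exact: svalP.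
exact: sval_inj.
Qed.

Lemma small_set (I : Type) : Small I -> Small (set I).
Proof.
move=> sI; apply: small_le (K_lim sI).
by apply: (card_le_fun (f := id)).
Qed.

(** By comparability both factors may be assumed to be the larger one, whose square
    embeds in its double power set; strong limits are closed under power sets. *)
Lemma small_prod (I J : Type) : Small I -> Small J -> Small (I * J).
Proof.
have aux (A B : Type) : [set: A] #<= [set: B] -> Small B -> Small (A * B).
  move=> /card_leT_inj[g gI] sB.
  apply: (small_inj (f := fun p => [set [set g p.1]; [set g p.1; p.2]])).
    (* Kuratowski pairs *)
    move=> [a b] [c d] /= e.
    have ac : a = c.
      have : [set [set g a]; [set g a; b]] [set g a] by left.
      rewrite e => -[] h; apply: gI.
        by have : [set g c] (g a) by rewrite -h.
      by have : [set g a] (g c) by rewrite h; left.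
    rewrite -ac in e *; congr pair.
    have : [set [set g a]; [set g a; d]] [set g a; b] by rewrite -e; right.
    have : [set [set g a]; [set g a; b]] [set g a; d] by rewrite e; right.
    have dd : [set g a; d] d by right.
    have bb : [set g a; b] b by right.
    move=> [] h1 [] h2; rewrite h1 /= in dd; rewrite h2 /= in bb.
    + by rewrite bb dd.
    + by case: bb => [->|//]; rewrite dd.
    + by case: dd => [->|//]; rewrite bb.
    + by case: dd => [dd|//]; case: bb => [bb|//]; rewrite bb dd.
    + exact: small_set (small_set sB).
move=> sI sJ; have [IJ|JI] := card_le_total I J; first exact: aux.
apply: (small_inj (f := fun p => (p.2, p.1))) (aux _ _ JI sI).
by move=> [a b] [c d] [-> ->].
Qed.

Lemma small_arrow (I J : Type) : Small I -> Small J -> Small (I -> J).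
Proof.
move=> sI sJ; apply: (small_inj (f := fun f => [set p | f p.1 = p.2])).
  move=> f g e; apply: funext => x.
  by have : [set p | f p.1 = p.2] (x, f x) by []; rewrite e => /= ->.
exact: small_set (small_prod sI sJ).
Qed.

Lemma small_countable (I : countType) : Small I.
Proof. exact: (small_inj (f := choice.pickle) (pcan_inj choice.pickleK)). Qed.

Lemma small_sum (I J : Type) : Small I -> Small J -> Small (I + J).
Proof.
have aux (A B : Type) : [set: A] #<= [set: B] -> Small B -> Small (A + B).
  move=> /card_leT_inj[g gI] sB.
  apply: (small_inj (f := fun v => match v with
    | inl a => (true, g a) | inr b => (false, b) end)).
    by move=> [a|b] [c|d] // [] => [/gI|] ->.
  exact: small_prod (small_countable bool) sB.
move=> sI sJ; have [IJ|JI] := card_le_total I J; first exact: aux.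
apply: (small_inj (f := fun v => match v with
  | inl a => inr a | inr b => inl b end)) (aux _ _ JI sI).
by move=> [a|b] [c|d] // [->].
Qed.

Lemma small_setU (I : Type) (A B : set I) :
  small K A -> small K B -> small K (A `|` B).
Proof.
move=> sA sB.
pose f := glue (sval : {x | A x} -> I) (sval : {x | B x} -> I).
apply: (@small_sub _ _ (range f)); last first.
  by apply: small_range; apply: small_sum; apply: small_sig.
by move=> x [Ax|Bx]; [exists (inl (exist _ x Ax))|exists (inr (exist _ x Bx))].
Qed.

Lemma small_sigma_ord (k : nat) (H : 'I_k -> Type) :
  (forall j, Small (H j)) -> Small {j & H j}.
Proof.
elim: k H => [|k IH] H sH.
  by apply: (small_inj (f := fun _ => 0)) K_nat => -[[]].
pose H' (j : 'I_k) := H (lift ord0 j).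
have sH' : Small (H ord0 + {j & H' j})%type.
  by apply: small_sum => //; apply: IH => j; apply: sH.
pose back (v : (H ord0 + {j & H' j})%type) : {j & H j} :=
  match v with
  | inl h => existT _ ord0 h
  | inr p => existT _ (lift ord0 (projT1 p)) (projT2 p)
  end.
apply: (@small_sub _ _ (range back)); last exact: small_range sH'.
move=> -[j h] _; case: (unliftP ord0 j) h => [i|] -> h.
  by exists (inr (existT _ i h)).
by exists (inl h).
Qed.

End Small.

(** * Formulas, their finite support, and elementary substructures *)

Section Syntax.
Context {L : language}.

Lemma eval_rename (U : structure L) (V W : Type) (f : V -> W) (e : W -> U)
    (t : term L V) : eval e (rename_term f t) = eval (e \o f) t.
Proof.
elim: t => [//|g ts IH] /=; congr fun_interp.
by apply: funext => k; apply: IH.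
Qed.

Lemma sat_rename (U : structure L) (V W : Type) (f : V -> W)
    (phi : formula L V) (e : W -> U) :
  sat (rename f phi) e <-> sat phi (e \o f).
Proof.
elim: phi W f e => [V'|V' t u|V' r ts|V' p IHp q IHq|V' p IH] W f e //=.
- by rewrite !eval_rename.
- have -> // : (fun k => eval e (rename_term f (ts k)))
    = (fun k => eval (e \o f) (ts k)) by apply: funext => k; apply: eval_rename.
- by rewrite IHp IHq.
- have E x : oapp e x \o omap f = oapp (e \o f) x by apply: funext => -[].
  by split=> H x; move: (H x); rewrite IH E.
Qed.

Lemma rename_rename (V W X : Type) (f : V -> W) (g : W -> X) (phi : formula L V) :
  rename g (rename f phi) = rename (g \o f) phi.
Proof.
have term_rename V' W' X' (f' : V' -> W') (g' : W' -> X') (t : term L V') :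
    rename_term g' (rename_term f' t) = rename_term (g' \o f') t.
  elim: t => [//|h ts IH] /=; congr App; exact: funext.
elim: phi W X f g => [V'|V' t u|V' r ts|V' p IHp q IHq|V' p IH] W X f g //=.
- by rewrite !term_rename.
- by congr Rel; apply: funext => k; apply: term_rename.
- by rewrite IHp IHq.
- by rewrite IH; congr All; congr rename; apply: funext => -[].
Qed.

Lemma eval_aut (U : structure L) (s : U -> U) (V : Type) (t : term L V) e :
  automorphism s -> eval (s \o e) t = s (eval e t).
Proof.
move=> [_ sf _]; elim: t => [//|g ts IH] /=; rewrite sf; congr fun_interp.
by apply: funext => k; apply: IH.
Qed.

Lemma sat_aut (U : structure L) (s : U -> U) (V : Type) (phi : formula L V)
    (e : V -> U) : automorphism s -> sat phi (s \o e) <-> sat phi e.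
Proof.
move=> sA; have [sB sf sr] := sA.
elim: phi e => [V'|V' t u|V' r ts|V' p IHp q IHq|V' p IH] e //=.
- by rewrite !eval_aut //; split=> [/(bij_inj sB)|->] .
- suff -> : (fun k => eval (s \o e) (ts k)) = s \o (fun k => eval e (ts k)).
    exact: sr.
  by apply: funext => k; apply: eval_aut.
- by rewrite IHp IHq.
- have E x : oapp (s \o e) (s x) = s \o oapp e x by apply: funext => -[].
  split=> H x; first by rewrite -IH -E.
  by have [s' s'K sK] := sB; rewrite -(sK x) E IH.
Qed.

(** The retraction [r] and section [t] exhibit the variables of the support,
    those with [t (r v) = Some v], as a finite set without choosing a default
    variable, which might not exist. *)
Lemma finite_support (V : Type) (phi : formula L V) :
  exists (n : nat) (r : V -> 'I_n.+1) (t : 'I_n.+1 -> option V),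
    forall (U : structure L) (e e' : V -> U),
      (forall v, t (r v) = Some v -> e v = e' v) -> sat phi e <-> sat phi e'.
Proof.
have term_supp W (u : term L W) : exists s : seq W,
    forall (U : structure L) (e e' : W -> U),
      (forall v, List.In v s -> e v = e' v) -> eval e u = eval e' u.
  elim: u => [v|g ts IH].
    by exists [:: v] => U e e' ee' /=; apply: ee'; left.
  have [s sP] := choice IH.
  exists (flatten [seq s k | k <- enum 'I_(funs_ar g)]) => U e e' ee' /=.
  congr fun_interp; apply: funext => k; apply: sP => v vk; apply: ee'.
  have : k \in enum 'I_(funs_ar g) by rewrite mem_enum.
  elim: (enum _) => //= j l IHl; rewrite inE => /orP[/eqP <-|/IHl h].
    by apply/List.in_app_iff; left.
  by apply/List.in_app_iff; right.
have [s sP] : exists s : seq V, forall (U : structure L) (e e' : V -> U),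
    (forall v, List.In v s -> e v = e' v) -> sat phi e <-> sat phi e'.
  elim: phi => [V'|V' t u|V' r ts|V' p [s sP] q [s' sP']|V' p [s sP]] /=.
  - by exists [::].
  - have [s sP] := term_supp _ t; have [s' sP'] := term_supp _ u.
    exists (s ++ s') => U e e' ee'.
    rewrite (sP _ e e') ?(sP' _ e e') // => v vs; apply: ee'.
      by apply/List.in_app_iff; right.
    by apply/List.in_app_iff; left.
  - have [s sP] := choice (fun k => term_supp _ (ts k)).
    exists (flatten [seq s k | k <- enum 'I_(rels_ar r)]) => U e e' ee' /=.
    suff -> : (fun k => eval e (ts k)) = (fun k => eval e' (ts k)) by [].
    apply: funext => k; apply: sP => v vk; apply: ee'.
    have : k \in enum 'I_(rels_ar r) by rewrite mem_enum.
    elim: (enum _) => //= j l IHl; rewrite inE => /orP[/eqP <-|/IHl h].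
      by apply/List.in_app_iff; left.
    by apply/List.in_app_iff; right.
  - exists (s ++ s') => U e e' ee'.
    rewrite (sP _ e e') ?(sP' _ e e') // => v vs; apply: ee'.
      by apply/List.in_app_iff; right.
    by apply/List.in_app_iff; left.
  - exists (pmap id s) => U e e' ee'.
    have h x : sat p (oapp e x) <-> sat p (oapp e' x).
      apply: sP => -[v|] //= vs; apply: ee'.
      elim: s vs => //= -[w|] l IHl /= [] //.
        by move=> [->]; left.
      by move/IHl; right.
    by split=> H x; apply/h.
suff [n [r [t rt]]] : exists n (r : V -> 'I_n.+1) (t : 'I_n.+1 -> option V),
    forall v, List.In v s -> t (r v) = Some v.
  by exists n, r, t => U e e' ee'; apply: sP => v /rt; apply: ee'.
clear sP; elim: s => [|w s [n [r [t rt]]]].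
  by exists 0, (fun=> ord0), (fun=> None).
exists n.+1, (fun v => if pselect (v = w) then ord0 else lift ord0 (r v)),
  (fun k => if unlift ord0 k is Some j then t j else Some w).
move=> v; case: pselect => [vw|nvw] /= [wv|vs]; rewrite ?unlift_none ?liftK.
- by rewrite vw.
- by rewrite vw.
- by case: nvw.
- exact: rt.
Qed.

Lemma sat_exists (V W : Type) (phi : formula L (V + W)) :
  exists psi : formula L V, forall (U : structure L) (e : V -> U),
    sat psi e <-> exists y : W -> U, sat phi (glue e y).
Proof.
have ex_n n V' (p : formula L (V' + 'I_n)) : exists psi : formula L V',
    forall (U : structure L) (e : V' -> U),
      sat psi e <-> exists y : 'I_n -> U, sat p (glue e y).
  elim: n V' p => [|n IH] V' p.
    pose absurd (k : 'I_0) : V' :=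
      match notF (ltn_ord k : is_true false) with end.
    exists (rename (glue id absurd) p) => U e.
    have E y : e \o glue id absurd = glue e y by apply: funext => -[v|[]].
    rewrite sat_rename; split=> [h|[y]]; last by rewrite (E y).
    have y : 'I_0 -> U by case.
    by exists y; rewrite -(E y).
  pose r v : option V' + 'I_n := match v with
    | inl v => inl (Some v)
    | inr k => if unlift ord0 k is Some j then inr j else inl None end.
  have [psi psiP] := IH _ (rename r p).
  exists (Not (All (Not psi))) => U e /=; split.
    move=> /existsNP[x /contrapT/psiP[y]]; rewrite sat_rename => h.
    exists (fun k => if unlift ord0 k is Some j then y j else x).
    suff -> : glue e (fun k => if unlift ord0 k is Some j then y j else x)
      = glue (oapp e x) y \o r by [].
    by apply: funext => -[v|k] //=; case: (unlift ord0 k).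
  move=> [y h] /(_ (y ord0)); apply; apply/psiP.
  exists (fun j => y (lift ord0 j)); rewrite sat_rename.
  suff -> : glue (oapp e (y ord0)) (fun j => y (lift ord0 j)) \o r = glue e y by [].
  by apply: funext => -[v|k] //=; case: unliftP => [j|] ->.
have [n [r [t supp]]] := finite_support phi.
pose r' v : V + 'I_n.+1 := match v with
  | inl v => inl v | inr w => inr (r (inr w)) end.
have [psi psiP] := ex_n _ _ (rename r' phi).
exists psi => U e; rewrite psiP; split=> -[y]; rewrite ?sat_rename => h.
  exists (fun w => y (r (inr w))).
  suff -> : glue e (fun w => y (r (inr w))) = glue e y \o r' by [].
  by apply: funext => -[].
have [u0] := carrier_inhabited U.
exists (fun k => oapp (glue (fun=> u0) y) u0 (t k)); rewrite sat_rename.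
apply/(supp _ _ _ _).1: h => -[v|w] //= tr.
by rewrite /= tr.
Qed.

(** Tarski-Vaught for tuples of any length, from the one-step criterion hidden
    in [elementary_sub]. *)
Lemma elementary_exists (U : structure L) (M : set U) (I J : Type)
    (phi : formula L (I + J)) (m : I -> {c | M c}) (y : J -> U) :
  elementary_sub M -> sat phi (glue (sval \o m) y) ->
  exists m' : J -> {c | M c}, sat phi (glue (sval \o m) (sval \o m')).
Proof.
move=> [ne [cl el]] h; have [psi psiP] := sat_exists phi.
have el' V (p : formula L V) (e : V -> substructure ne cl) :
    sat p e <-> sat p (fun v => sval (e v) : U).
  have [n [r [t supp]]] := finite_support p.
  have [c0] := ne.
  pose e0 k : substructure ne cl := oapp e c0 (t k).
  have -> : sat p e <-> sat (rename r p) e0.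
    by rewrite sat_rename; apply: supp => v /= tr; rewrite /e0 /= tr.
  rewrite el sat_rename; apply: supp => v /= tr; by rewrite /e0 tr.
have : sat psi (sval \o m : I -> U) by apply/psiP; exists y.
rewrite -(el' _ psi m) => /psiP[m' hm'].
exists m'; move: hm'; rewrite el'.
suff -> : (fun v => sval (glue m m' v : substructure ne cl))
  = glue (sval \o m) (sval \o m') by [].
by apply: funext => -[].
Qed.

Lemma elementary_inhabited (U : structure L) (M : set U) :
  elementary_sub M -> inhabited {c | M c}.
Proof. by move=> [ne _]. Qed.

End Syntax.

(** * Heights of antichain trees *)

Section Conjunctions.
Context {L : language}.

Fixpoint Ands (V : Type) (l : seq (formula L V)) : formula L V :=
  if l is p :: l then Not (Imp p (Not (Ands l))) else Not Bot.

Fixpoint Alls (A : Type) (P : A -> Prop) (l : seq A) : Prop :=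
  if l is a :: l then P a /\ Alls P l else True.

Lemma AllsP (A : eqType) (P : A -> Prop) (l : seq A) :
  Alls P l <-> forall a, a \in l -> P a.
Proof.
elim: l => [|a l IH] //=; rewrite IH; split=> [[Pa h] b|h].
  by rewrite inE => /orP[/eqP->|/h].
by split=> [|b bl]; apply: h; rewrite inE ?eqxx ?bl ?orbT.
Qed.

Lemma Alls_map (A B : Type) (f : A -> B) (P : B -> Prop) (l : seq A) :
  Alls P (map f l) <-> Alls (P \o f) l.
Proof. by elim: l => [|a l IH] //=; rewrite IH. Qed.

Lemma Alls_cat (A : Type) (P : A -> Prop) (l l' : seq A) :
  Alls P (l ++ l') <-> Alls P l /\ Alls P l'.
Proof. by elim: l => [|a l IH] /=; [split=> [|[]]|rewrite IH; tauto]. Qed.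

Lemma Alls_impl (A : Type) (P Q : A -> Prop) (l : seq A) :
  (forall a, P a -> Q a) -> Alls P l -> Alls Q l.
Proof. by move=> PQ; elim: l => [|a l IH] //= [/PQ ? /IH]. Qed.

Lemma Alls_mask (A : Type) (P : A -> Prop) (b : bitseq) (l : seq A) :
  Alls P l -> Alls P (mask b l).
Proof. by elim: l b => [|a l IH] [|[] b] //= [Pa /IH]; auto. Qed.

Lemma sat_Ands (U : structure L) (V : Type) (l : seq (formula L V)) (e : V -> U) :
  sat (Ands l) e <-> Alls (fun p => sat p e) l.
Proof.
elim: l => [|p l IH] /=; first by split.
by rewrite -IH; split=> [/not_implyP[? /contrapT]|[sp sl] /(_ sp)].
Qed.

End Conjunctions.

Section Heights.
Context {L : language} {T : theory L} {K : Type} {U : structure L}.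
Context (hU : monster_model K T U).

Let K_nat : small K [set: nat] := monster_uncountable hU.

Definition antichain_seq (l : seq (seq bool)) : Prop :=
  forall eta nu, eta \in l -> nu \in l -> prefix eta nu -> eta = nu.

(** By compactness, a formula without ATP fails to have an antichain tree
    already at some finite height. *)
Lemma NATP_height (n : nat) (Y : finType) (psi : formula L ('I_n + Y)) :
  NATP U -> exists h : nat, forall a : seq bool -> Y -> U,
    (forall l, antichain_seq l -> (forall eta, eta \in l -> size eta < h)%N ->
       exists x : 'I_n -> U, Alls (fun eta => sat psi (glue x (a eta))) l) ->
    exists eta nu, [/\ prefix eta nu, eta <> nu, (size nu < h)%N &
      exists x : 'I_n -> U, sat psi (glue x (a eta)) /\ sat psi (glue x (a nu))].
Proof.
move=> natp; apply: contrapT => /forallNP nh.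
have bad h : exists a : seq bool -> Y -> U,
    (forall l, antichain_seq l -> (forall eta, eta \in l -> size eta < h)%N ->
       exists x : 'I_n -> U, Alls (fun eta => sat psi (glue x (a eta))) l) /\
    (forall eta nu, prefix eta nu -> eta <> nu -> (size nu < h)%N ->
      ~ exists x : 'I_n -> U, sat psi (glue x (a eta)) /\ sat psi (glue x (a nu))).
  have /existsNP[a] := nh h; rewrite not_implyE => -[h1 h2].
  by exists a; split=> // eta nu p1 p2 p3 p4; apply: h2; exists eta, nu.
have {bad nh} [a aP] := choice bad.
pose at_h h (v : seq bool * Y) : U := a h v.1 v.2.
(* the formulas that hold in all sufficiently high trees *)
pose p : set (pformula (seq bool * Y)) := [set phi |
  exists2 phi0 : formula L (seq bool * Y + {c : U | set0 c}), phi = subst phi0 sval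
    & exists h0, forall h, (h0 <= h)%N -> psat (at_h h) phi].
have psatE (b : seq bool * Y -> U) (phi : formula L (seq bool * Y)) :
    psat b (subst (rename inl phi : formula L (_ + {c : U | set0 c})) sval)
    <-> sat phi b by rewrite /psat !sat_rename.
have [| |phi [phi0 -> _]| |b bp] := @monster_saturated _ _ _ _ hU _ set0 p.
- exact: small_countable.
- exact: small_le (card_ge0 U [set: nat]) K_nat.
- by exists phi0.
- move=> k phis pphis; have [f fP] := choice (fun j =>
    let: ex_intro2 _ _ h := pphis j in h).
  exists (at_h (\max_j f j)) => // j; apply: fP; exact: leq_bigmax.
have eventually (phi : formula L (seq bool * Y)) h0 :
    (forall h, (h0 <= h)%N -> sat phi (at_h h)) -> sat phi b.
  move=> h; apply/psatE; apply: bp; exists (rename inl phi) => //.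
  by exists h0 => h1 /h ?; apply/psatE.
have conj_form (l : seq (seq bool)) : exists phi : formula L (seq bool * Y),
    forall e, sat phi e <-> exists x : 'I_n -> U,
      Alls (fun eta => sat psi (glue x (fun y => e (eta, y)))) l.
  pose q (eta : seq bool) := rename (glue inr (fun y => inl (eta, y))) psi.
  have [phi phiP] := sat_exists (Ands [seq q eta | eta <- l]).
  exists phi => e; rewrite phiP.
  have qE eta (x : 'I_n -> U) :
      sat (q eta) (glue e x) <-> sat psi (glue x (fun y => e (eta, y))).
    rewrite sat_rename; suff -> : glue e x \o glue inr (fun y => inl (eta, y))
      = glue x (fun y => e (eta, y)) by [].
    by apply: funext => -[].
  split=> -[x xP]; exists x; last first.
    apply/sat_Ands/Alls_map; apply: Alls_impl xP => eta; exact: (qE eta x).2.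
  by move/sat_Ands/Alls_map: xP; apply: Alls_impl => eta; exact: (qE eta x).1.
pose r : 'I_n + Y -> 'I_n + 'I_#|Y| := glue inl (inr \o enum_rank).
pose b' (eta : seq bool) (k : 'I_#|Y|) : U := b (eta, enum_val k).
have psiE eta (x : 'I_n -> U) : psat x (subst (rename r psi) (b' eta))
    <-> sat psi (glue x (fun y => b (eta, y))).
  rewrite /psat !sat_rename; suff -> : (glue x id \o glue inl (inr \o b' eta)) \o r
    = glue x (fun y => b (eta, y)) by [].
  by apply: funext => -[//|y] /=; rewrite /b' enum_rankK.
apply: (natp _ _ (rename r psi)); exists b'; split=> [X X_anti k phis phisX|].
  have [f fP] := choice (fun j => let: ex_intro2 e h1 h2 := phisX j in
    ex_intro (fun e => X e /\ subst (rename r psi) (b' e) = phis j) e (conj h1 h2)).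
  pose l := [seq f j | j <- enum 'I_k].
  have [phi phiP] := conj_form l.
  have : sat phi b.
    apply: (eventually _ (\max_(eta <- l) size eta).+1) => h hmax; apply/phiP.
    have [aP1 _] := aP h; apply: aP1 => [eta nu|eta etal].
      by move=> /mapP[i _ ->] /mapP[j _ ->]; apply: X_anti; case: (fP i); case: (fP j).
    by apply: leq_trans hmax; rewrite ltnS; apply: leq_bigmax_seq.
  move=> /phiP[x /AllsP xP]; exists x => // j; have [_ <-] := fP j.
  by apply/psiE; apply: xP; apply: map_f; rewrite mem_enum.
move=> eta nu eta_nu neq cons.
have [x _ xP] := cons _ (fun j : 'I_2 => subst (rename r psi)
    (b' (if j == ord0 then eta else nu))) (fun j => if j == ord0 as c return
    [set subst (rename r psi) (b' eta); subst (rename r psi) (b' nu)]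
      (subst (rename r psi) (b' (if c then eta else nu)))
    then or_introl erefl else or_intror erefl).
have [phi phiP] := conj_form [:: eta; nu].
suff : sat (Not phi) b.
  apply; apply/phiP; exists x; split; first by apply/psiE; exact: (xP ord0).
  by split=> //; apply/psiE; exact: (xP ord_max).
apply: (eventually _ (size nu).+1) => h hnu /phiP[y [y1 [y2 _]]].
by have [_ aP2] := aP h; apply: (aP2 eta nu eta_nu neq hnu); exists y.
Qed.

End Heights.

(** * Types over small sets in the monster model *)

Section Monster.
Context {L : language} {T : theory L} {K : Type} {U : structure L}.
Context (hU : monster_model K T U).

Local Notation Small I := (small K [set: I]).

Let K_nat : Small nat := monster_uncountable hU.
Let K_lim : strong_limit K := monster_strong_limit hU.

Definition fixes (s : U -> U) (E : set U) : Prop := forall c, E c -> s c = c.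

(** Formulas over [E] are used with an arbitrary type [P] of names for their
    parameters, so that no coercion is needed when [E] varies. *)
Lemma equivP (I : Type) (E : set U) (a a' : I -> U) :
  equiv E a a' <-> forall (P : Type) (phi : formula L (I + P)) (e : P -> U),
    (forall p, E (e p)) -> sat phi (glue a e) <-> sat phi (glue a' e).
Proof.
have tpE (b : I -> U) (phi : formula L (I + {c | E c})) :
    tp b E (subst phi sval) <-> sat phi (glue b sval).
  have -> : sat phi (glue b sval) <-> psat b (subst phi sval).
    rewrite /psat sat_rename; suff -> : glue b id \o glue inl (inr \o sval)
      = glue b sval :> (I + {c | E c} -> U) by [].
    by apply: funext => -[].
  by split=> [[_]|h] //; split=> //; exists phi.
split=> [aa' P phi e eE|h].
  pose e' p : {c | E c} := exist _ (e p) (eE p).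
  have h b : sat phi (glue b e)
      <-> sat (rename (glue inl (inr \o e')) phi) (glue b sval).
    by rewrite sat_rename; suff -> : glue b sval \o glue inl (inr \o e') = glue b e
      by []; apply: funext => -[].
  by rewrite !h -!tpE aa'.
apply/seteqP; split=> _ [[phi _ <-] sphi].
  by apply/tpE; rewrite -h; [apply/tpE; split=> //; exists phi|exact: svalP].
by apply/tpE; rewrite h; [apply/tpE; split=> //; exists phi|exact: svalP].
Qed.

Lemma automorphism_id : automorphism (id : U -> U).
Proof. by split=> [|f t|r t] //; exists id. Qed.

Lemma automorphism_comp (s s' : U -> U) :
  automorphism s -> automorphism s' -> automorphism (s' \o s).
Proof.
move=> [sB sf sr] [sB' sf' sr']; split; first exact: bij_comp.
  by move=> f t /=; rewrite sf sf'.
by move=> r t; apply: iff_trans (sr' _ (s \o t)) (sr _ t).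
Qed.

Lemma automorphism_inv (s : U -> U) : automorphism s ->
  exists s', [/\ automorphism s', cancel s s' & cancel s' s].
Proof.
move=> [[s' sK s'K] sf sr]; exists s'; split=> //; split.
- by exists s.
- move=> f t; apply: (can_inj sK); rewrite s'K sf; congr fun_interp.
  by apply: funext => k /=; rewrite s'K.
- move=> r t; rewrite -sr; suff -> : s \o (s' \o t) = t by [].
  by apply: funext => k /=; rewrite s'K.
Qed.

Lemma aut_equiv (I : Type) (E : set U) (s : U -> U) (a : I -> U) :
  automorphism s -> fixes s E -> equiv E a (s \o a).
Proof.
move=> sA sE; apply/equivP => P phi e eE.
rewrite -(sat_aut _ (glue a e) sA); suff -> : s \o glue a e = glue (s \o a) e by [].
by apply: funext => -[//|p] /=; apply: sE; apply: eE.
Qed.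

Lemma equiv_aut (I : Type) (E : set U) (a a' : I -> U) :
  Small I -> small K E -> equiv E a a' ->
  exists s, [/\ automorphism s, fixes s E & s \o a = a'].
Proof.
move=> sI sE /equivP aa'.
have [|s sA sa] := @monster_homogeneous _ _ _ _ hU (I + {c | E c})%type
    (glue a sval) (glue a' sval) (small_sum K_nat K_lim sI (small_sig sE)).
  apply/equivP => P phi e e0.
  have E0 b : glue (glue b sval) e
      = glue b (glue sval e) \o glue (glue inl (inr \o inl)) (inr \o inr)
      :> (_ -> U) by apply: funext => -[[]|].
  rewrite !(E0 _) -!sat_rename; apply: aa' => -[c|p] /=; first exact: svalP.
  by case: (e0 p).
exists s; split=> // [c Ec|]; first exact: (sa (inr (exist _ c Ec))).
by apply: funext => i; apply: (sa (inl i)).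
Qed.

Section OverM.
Context (M : set U) (hM : small_model K M).

Let M_small : small K M := proj1 hM.
Let M_elem : elementary_sub M := proj2 hM.

(** What is used of an [M]-invariant global type: which tuples realize it over a
    small set [E].  Uniqueness is stated through automorphisms, which by
    homogeneity of the monster model is equality of types over [E]. *)
Record generic (I : Type) (G : set U -> (I -> U) -> Prop) : Prop := Generic {
  generic_ex : forall E, M `<=` E -> small K E -> exists a, G E a;
  generic_aut : forall s E E' a, automorphism s -> fixes s M ->
    E' `<=` s @` E -> G E a -> G E' (s \o a);
  generic_uniq : forall E a a', M `<=` E -> small K E -> G E a -> G E a' ->
    exists s, [/\ automorphism s, fixes s E & s \o a = a'] }.

Lemma generic_mono (I : Type) (G : set U -> (I -> U) -> Prop) E E' a :
  generic G -> E' `<=` E -> G E a -> G E' a.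
Proof.
move=> gG EE' Ga; apply: (generic_aut gG automorphism_id) Ga => //.
by rewrite image_id.
Qed.

(** A Morley sequence has constant [Gs]; words in several types come from the levels
    of a tree. *)
Fixpoint gens (I : Type) (E : set U) (Gs : seq (set U -> (I -> U) -> Prop))
    (l : seq (I -> U)) : Prop :=
  match Gs, l with
  | [::], [::] => True
  | G :: Gs, a :: l => G E a /\ gens (E `|` range a) Gs l
  | _, _ => False
  end.

Lemma small_setUrange (I : Type) (E : set U) (a : I -> U) :
  Small I -> small K E -> small K (E `|` range a).
Proof. by move=> sI sE; apply: small_setU => //; apply: small_range. Qed.

Lemma gens_aut (I : Type) s E E' (Gs : seq (set U -> (I -> U) -> Prop)) l :
  Alls (@generic I) Gs -> automorphism s -> fixes s M -> E' `<=` s @` E ->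
  gens E Gs l -> gens E' Gs [seq s \o a | a <- l].
Proof.
move=> gGs sA sM; elim: Gs l E E' gGs => [|G Gs IH] [|a l] //= E E' [gG gGs] sE.
move=> [Ga h]; split; first exact: (generic_aut gG) Ga.
apply: IH h => // c [/sE[d Ed <-]|[i _ <-]]; first by exists d => //; left.
by exists (a i) => //; right; exists i.
Qed.

Lemma gens_mono (I : Type) E E' (Gs : seq (set U -> (I -> U) -> Prop)) l :
  Alls (@generic I) Gs -> E' `<=` E -> gens E Gs l -> gens E' Gs l.
Proof.
move=> gGs sE /(gens_aut gGs automorphism_id (E' := E')); rewrite image_id.
have -> : [seq id \o a | a <- l] = l by apply: map_id.
exact.
Qed.

(** This is how consistency passes from one generated sequence to all those generated
    by the same types. *)
Lemma gens_uniq (I : Type) E (Gs : seq (set U -> (I -> U) -> Prop)) l l' :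
  Small I -> Alls (@generic I) Gs -> M `<=` E -> small K E ->
  gens E Gs l -> gens E Gs l' ->
  exists s, [/\ automorphism s, fixes s E & [seq s \o a | a <- l] = l'].
Proof.
move=> sI; elim: Gs l l' E => [|G Gs IH] [|a l] [|a' l'] //= E.
  by move=> *; exists id; split=> //; apply: automorphism_id.
move=> [gG gGs] ME sE [Ga gl] [Ga' gl'].
have [s [sA sfix saa']] := generic_uniq gG ME sE Ga Ga'.
have sM : fixes s M by move=> c /ME; apply: sfix.
have gl2 : gens (E `|` range a') Gs [seq s \o b | b <- l].
  apply: (gens_aut gGs sA sM) gl => c [Ec|[i _ <-]].
    by exists c; [left|apply: sfix].
  by exists (a i); [right; exists i|rewrite -saa'].
have [||s' [sA' sfix' e]] := IH _ _ _ gGs _ _ gl2 gl'.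
- by move=> c /ME; left.
- exact: small_setUrange.
exists (s' \o s); split.
- exact: automorphism_comp.
- by move=> c Ec /=; rewrite sfix // sfix' //; left.
- rewrite -e -map_comp; congr cons; apply: funext => i /=.
  by rewrite -saa' /= sfix' //; right; exists i => //; rewrite -saa'.
Qed.

Lemma gens_ex (I : Type) E (Gs : seq (set U -> (I -> U) -> Prop)) :
  Small I -> Alls (@generic I) Gs -> M `<=` E -> small K E ->
  exists l, gens E Gs l.
Proof.
move=> sI; elim: Gs E => [|G Gs IH] E; first by exists [::].
move=> [gG gGs] ME sE; have [a Ga] := generic_ex gG ME sE.
have [||l gl] := IH (E `|` range a) gGs; [by move=> c /ME; left|
  exact: small_setUrange|by exists (a :: l)].
Qed.

(** * Towers of trees under NATP *)

Lemma generic_reindex (I I' : Type) (f : I' -> I + {c | M c}) G :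
  Small I -> generic G ->
  generic (fun E a' => exists2 a : I -> U, G E a & a' = glue a sval \o f).
Proof.
move=> sI gG; split=> [E ME sE|s E E' _ sA sM sE [a Ga ->]|
  E _ _ ME sE [a Ga ->] [a' Ga' ->]].
- by have [a Ga] := generic_ex gG ME sE; exists (glue a sval \o f); exists a.
- exists (s \o a); first exact: (generic_aut gG) Ga.
  apply: funext => i /=; case: (f i) => //= c; apply: sM; exact: svalP.
- have [s [sA sfix saa']] := generic_uniq gG ME sE Ga Ga'.
  exists s; split=> //; rewrite -saa'; apply: funext => i /=; case: (f i) => //= c.
  by apply/sfix/ME; apply: svalP.
Qed.

Definition cone (Y : Type) (nu : seq bool) (B : seq bool * Y -> U) :
  seq bool * Y -> U := fun v => B (nu ++ v.1, v.2).

Definition node (Y : Type) (B : seq bool * Y -> U) (nu : seq bool) : Y -> U :=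
  fun y => B (nu, y).

Definition at_node (Y : Type) (nu : seq bool)
    (G : set U -> (seq bool * Y -> U) -> Prop) : set U -> (Y -> U) -> Prop :=
  fun E a => exists2 B, G E B & a = node B nu.

(** [G h] is the type of a binary tree of height [h], given on all of [seq bool] with
    irrelevant values from height [h] on.  The cones at its two lower neighbours of
    the root are trees of height one less, the right one generic over the left one;
    so the type of a cone depends on its level only. *)
Definition tower (Y : Type) (D : nat)
    (G : nat -> set U -> (seq bool * Y -> U) -> Prop) : Prop :=
  (forall n, generic (G n)) /\
  forall n E B, (n < D)%N -> M `<=` E -> G n.+1 E B ->
    G n E (cone [:: false] B) /\
    G n (E `|` range (cone [:: false] B)) (cone [:: true] B).

Definition sprefix (eta nu : seq bool) : bool := prefix eta nu && (eta != nu).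

Definition satisfiable (n : nat) (Y : Type) (psi : formula L ('I_n + Y))
    (l : seq (Y -> U)) : Prop :=
  exists x : 'I_n -> U, Alls (fun a => sat psi (glue x a)) l.

(** A form of the antichain tree property for towers.  Words, that is, roots of trees
    of heights taken in any order, each generic over the earlier roots, are jointly
    satisfiable; in particular antichains are, being words from left to right.  But
    [c] nodes on a branch are not.  All heights are asked for, as well as words of all
    lengths, because replacing nodes by pairs of nodes lowers both. *)
Definition admits_towers (n m : nat) (psi : formula L ('I_n + 'I_m)) (c : nat) :=
  forall D s : nat, exists G : nat -> set U -> (seq bool * 'I_m -> U) -> Prop,
    [/\ tower D G,
      forall (ns : seq nat) l, (size ns <= s)%N ->
        (forall g, g \in ns -> 0 < g <= D)%N ->
        gens M [seq at_node [::] (G g) | g <- ns] l -> satisfiable psi l &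
      forall g B (l : seq (seq bool)), (g <= D)%N -> G g M B -> (c <= size l)%N ->
        pairwise sprefix l -> (forall eta, eta \in l -> size eta < g)%N ->
        ~ satisfiable psi [seq node B eta | eta <- l]].

Lemma small_tree (m : nat) : Small (seq bool * 'I_m).
Proof. exact: small_countable. Qed.

Lemma generic_node (m : nat) nu (G : set U -> (seq bool * 'I_m -> U) -> Prop) :
  generic G -> generic (at_node nu G).
Proof.
move=> gG; pose f (y : 'I_m) : seq bool * 'I_m + {c | M c} := inl (nu, y).
exact: (generic_reindex f (small_tree m) gG).
Qed.

Lemma cone_nil (Y : Type) (B : seq bool * Y -> U) : cone [::] B = B.
Proof. by apply: funext => -[]. Qed.

Lemma tower_cone (Y : Type) D (G : nat -> set U -> (seq bool * Y -> U) -> Prop)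
    n nu E B :
  tower D G -> (n + size nu <= D)%N -> M `<=` E -> G (n + size nu)%N E B ->
  G n E (cone nu B).
Proof.
move=> [gG tG]; elim: nu B => [|b nu IH] B; first by rewrite addn0 cone_nil.
rewrite addnS => nD ME GB; have [G0 G1] := tG _ _ _ nD ME GB.
have -> : cone (b :: nu) B = cone nu (cone [:: b] B) by [].
apply: IH (ltnW nD) ME _; case: b {GB} => //.
by apply: (generic_mono (gG _)) G1; left.
Qed.

Lemma gens_cat (I : Type) E F (Gs Gs' : seq (set U -> (I -> U) -> Prop)) l l' :
  Alls (@generic I) Gs' -> E `<=` F -> Alls (fun a => range a `<=` F) l ->
  gens E Gs l -> gens F Gs' l' -> gens E (Gs ++ Gs') (l ++ l').
Proof.
move=> gGs' EF; elim: Gs l E EF => [|G Gs IH] [|a l] //= E EF.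
  by move=> _ _; apply: gens_mono.
move=> [aF lF] [Ga gl] gl'; split=> //; apply: IH => //.
by move=> c [/EF|/aF].
Qed.

Lemma gens_mask (I : Type) E (Gs : seq (set U -> (I -> U) -> Prop)) l (b : bitseq) :
  Alls (@generic I) Gs -> gens E Gs l -> gens E (mask b Gs) (mask b l).
Proof.
elim: Gs l E b => [|G Gs IH] [|a l] E [|[] b] //= [gG gGs] [Ga gl].
  by split=> //; apply: IH.
apply: (gens_mono (E := E `|` range a)); first exact: Alls_mask.
  by move=> c; left.
exact: IH.
Qed.

(** Left to right is the order in which every node of an antichain of a tree is
    generic over the previous ones. *)
Fixpoint lexl (h : nat) (X : pred (seq bool)) : seq (seq bool) :=
  if h is h.+1 then
    if X [::] then [:: [::]]
    else [seq false :: eta | eta <- lexl h (fun eta => X (false :: eta))] ++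
         [seq true :: eta | eta <- lexl h (fun eta => X (true :: eta))]
  else [::].

Lemma size_lexl h X : (size (lexl h X) <= 2 ^ h)%N.
Proof.
elim: h X => [|h IH] X //=; case: ifP => _; first by rewrite expn_gt0.
by rewrite size_cat !size_map expnS mul2n -addnn leq_add.
Qed.

Lemma lexl_size h X eta : eta \in lexl h X -> (size eta < h)%N.
Proof.
elim: h X eta => [|h IH] X eta //=; case: ifP => _; first by rewrite inE => /eqP->.
by rewrite mem_cat => /orP[] /mapP[nu /IH ? ->].
Qed.

Lemma mem_lexl h (X : pred (seq bool)) eta :
  (forall eta nu, X eta -> X nu -> prefix eta nu -> eta = nu) ->
  X eta -> (size eta < h)%N -> eta \in lexl h X.
Proof.
elim: h X eta => [|h IH] X eta //= X_anti Xeta eta_h; case: ifP => X0.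
  by rewrite inE; apply/eqP; rewrite -(X_anti [::] eta) ?prefix0s.
case: eta Xeta eta_h => [|b eta] Xeta eta_h; first by rewrite Xeta in X0.
have IHb : eta \in lexl h (fun eta => X (b :: eta)).
  apply: IH => // nu nu' Xnu Xnu' pnu; suff [] : b :: nu = b :: nu' by [].
  by apply: X_anti => //; rewrite prefix_cons eqxx.
by rewrite mem_cat; clear -IHb; case: b IHb => IHb; rewrite map_f ?orbT.
Qed.

Lemma all_generic_nodes (m : nat) D
    (G : nat -> set U -> (seq bool * 'I_m -> U) -> Prop) (A : Type) (f : A -> nat)
    (l : seq A) : tower D G ->
  Alls (@generic 'I_m) [seq at_node [::] (G (f g)) | g <- l].
Proof.
by move=> [gG _]; elim: l => [|g l IH] //=; split=> //; apply: generic_node.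
Qed.

Lemma gens_lexl (m : nat) D (G : nat -> set U -> (seq bool * 'I_m -> U) -> Prop)
    h (X : pred (seq bool)) g E B :
  tower D G -> (h <= g <= D)%N -> M `<=` E -> G g E B ->
  gens E [seq at_node [::] (G (g - size nu)) | nu <- lexl h X]%N
    [seq node B nu | nu <- lexl h X].
Proof.
move=> tG; elim: h X g E B => [//|h IH] X [|g] // E B hgD ME GB /=.
case: ifP => _ /=; first by split=> //; exists B => //; rewrite subn0.
have [_ gltD] := andP hgD; have [G0 G1] := tG.2 g E B gltD ME GB.
have gD : (h <= g <= D)%N by case/andP: hgD => ? /ltnW ->; rewrite andbT.
rewrite !map_cat -!map_comp.
apply: (gens_cat (F := E `|` range (cone [:: false] B))).
- exact: all_generic_nodes tG.
- by move=> c; left.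
- apply/Alls_map/AllsP => nu _ /= _ [y _ <-]; right; exists (nu, y) => //.
- exact: (IH (fun eta => X (false :: eta)) _ _ _ gD ME G0).
- by apply: (IH (fun eta => X (true :: eta)) _ _ _ gD _ G1) => c /ME; left.
Qed.

Lemma gens_size (I : Type) E (Gs : seq (set U -> (I -> U) -> Prop)) l :
  gens E Gs l -> size Gs = size l.
Proof. by elim: Gs l E => [|G Gs IH] [|a l] E //= [_ /IH ->]. Qed.

Lemma gens_parallel (m : nat) D
    (G : nat -> set U -> (seq bool * 'I_m -> U) -> Prop) h (X : pred (seq bool))
    (hs : seq nat) E Bs :
  tower D G -> (forall g, g \in hs -> h <= g <= D)%N -> M `<=` E ->
  gens E [seq G g | g <- hs] Bs ->
  gens E [seq at_node [::] (G g) |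
           g <- flatten [seq [seq (g - size nu)%N | nu <- lexl h X] | g <- hs]]
    (flatten [seq [seq node B nu | nu <- lexl h X] | B <- Bs]).
Proof.
move=> tG; elim: hs E Bs => [|g hs IH] E [|B Bs] //= hD ME [GB gBs].
rewrite map_cat -map_comp; apply: (gens_cat (F := E `|` range B)).
- exact: all_generic_nodes tG.
- by move=> c; left.
- by apply/Alls_map/AllsP => nu _ /= _ [y _ <-]; right; exists (nu, y).
- by apply: gens_lexl tG _ ME GB; apply: hD; rewrite inE eqxx.
- apply: IH gBs; first by move=> g' g'hs; apply: hD; rewrite inE g'hs orbT.
  by move=> c /ME; left.
Qed.

Definition double (n m : nat) (psi : formula L ('I_n + 'I_m)) :
    formula L ('I_n + 'I_(m + m)) :=
  Ands [:: rename (glue inl (inr \o @lshift m m)) psi;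
           rename (glue inl (inr \o @rshift m m)) psi].

Lemma sat_double (n m : nat) (psi : formula L ('I_n + 'I_m)) (x : 'I_n -> U) a :
  sat (double psi) (glue x a) <->
  sat psi (glue x (a \o @lshift m m)) /\ sat psi (glue x (a \o @rshift m m)).
Proof.
rewrite sat_Ands /= !sat_rename.
have E f : glue x a \o glue inl (inr \o f) = glue x (a \o f) :> ('I_n + 'I_m -> U).
  by apply: funext => -[].
by rewrite !E; tauto.
Qed.

Lemma satisfiable_double (n m : nat) (psi : formula L ('I_n + 'I_m)) l :
  satisfiable (double psi) l ->
  satisfiable psi (flatten [seq [:: a \o @lshift m m; a \o @rshift m m] | a <- l]).
Proof.
move=> [x xl]; exists x; elim: l xl => [|a l IH] //= [/sat_double[? ?] /IH] /=.
by split.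
Qed.

(** A tower of trees of blocks inside a tower of trees: the node [eta] of the new
    tree is the pair of old nodes at [nu] and [nu'] in the cone of the old tree
    above which one arrives by repeating the steps [kappa], [b] for [b] in [eta].
    New nodes beyond the height of the tower get the dummy value [m0]. *)
Section Blocks.
Context {m : nat} (nu nu' kappa : seq bool) (m0 : {c | M c}).

Fixpoint path_to (eta : seq bool) : seq bool :=
  if eta is b :: eta then kappa ++ b :: path_to eta else [::].

Definition block_var (g : nat) (v : seq bool * 'I_(m + m)) :
    seq bool * 'I_m + {c | M c} :=
  if (size v.1 < g)%N then
    match fintype.split v.2 with
    | inl y => inl (path_to v.1 ++ nu, y)
    | inr y => inl (path_to v.1 ++ nu', y)
    end
  else inr m0.

Definition blocks (g : nat) (B : seq bool * 'I_m -> U) :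
    seq bool * 'I_(m + m) -> U := glue B sval \o block_var g.

Lemma node_blocks g B eta : (size eta < g)%N ->
  node (blocks g B) eta \o @lshift m m = node B (path_to eta ++ nu) /\
  node (blocks g B) eta \o @rshift m m = node B (path_to eta ++ nu').
Proof.
move=> eta_g; split; apply: funext => y; rewrite /node /blocks /block_var /= eta_g.
  by have -> : @lshift m m y = fintype.unsplit (inl y) by []; rewrite fintype.unsplitK.
by have -> : @rshift m m y = fintype.unsplit (inr y) by []; rewrite fintype.unsplitK.
Qed.

Lemma cone_blocks g B b :
  cone [:: b] (blocks g.+1 B) = blocks g (cone (rcons kappa b) B).
Proof.
apply: funext => -[eta y]; rewrite /cone /blocks /block_var /= ltnS.
have E t : (kappa ++ b :: path_to eta) ++ t = rcons kappa b ++ path_to eta ++ t.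
  by rewrite -cats1 -!catA.
by case: ifP => //= _; case: (fintype.split y) => z /=; rewrite E.
Qed.

Lemma size_path_to eta : size (path_to eta) = (size eta * (size kappa).+1)%N.
Proof. by elim: eta => [|b eta IH] //=; rewrite size_cat /= IH mulSn addnS addSn. Qed.

Lemma path_to_cat eta eta' : path_to (eta ++ eta') = path_to eta ++ path_to eta'.
Proof. by elim: eta => [|b eta IH] //=; rewrite IH -catA. Qed.

Lemma range_blocks g B : range (blocks g B) `<=` range B `|` M.
Proof.
move=> _ [v _ <-]; rewrite /blocks /=; case: (block_var g v) => [w|c] /=.
  by left; exists w.
by right; apply: svalP.
Qed.

End Blocks.

Lemma sprefixP eta nu :
  reflect (exists b w, nu = eta ++ b :: w) (sprefix eta nu).
Proof.
apply: (iffP andP) => [[/prefixP[[|b w] ->]]|[b [w ->]]].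
- by rewrite cats0 eqxx.
- by exists b, w.
- rewrite prefix_prefix; split=> //; rewrite -{1}(cats0 eta) eqseq_cat //.
  by rewrite eqxx.
Qed.

Lemma sprefix_trans : transitive sprefix.
Proof.
move=> y x z /sprefixP[b [w ->]] /sprefixP[b' [w' ->]]; apply/sprefixP.
by exists b, (w ++ b' :: w'); rewrite -catA.
Qed.

Lemma subseq_repeat (ns : seq nat) D s : (size ns <= s)%N ->
  (forall g, g \in ns -> 0 < g <= D)%N -> subseq ns (flatten (nseq s (iota 1 D))).
Proof.
elim: ns s => [|g ns IH] [|s] //= ns_s nsD; first exact: sub0seq.
rewrite -cat1s; apply: cat_subseq; last first.
  by apply: IH => // g' g'ns; apply: nsD; rewrite inE g'ns orbT.
by rewrite sub1seq mem_iota add1n ltnS; apply: nsD; rewrite inE eqxx.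
Qed.

Lemma cone_cone (Y : Type) nu nu' (B : seq bool * Y -> U) :
  cone nu' (cone nu B) = cone (nu ++ nu') B.
Proof. by apply: funext => v; rewrite /cone /= catA. Qed.

Lemma Alls_flatten (A A' : Type) (P : A' -> Prop) (f : A -> seq A') (l : seq A) :
  Alls P (flatten [seq f a | a <- l]) <-> Alls (fun a => Alls P (f a)) l.
Proof. by elim: l => [|a l IH] //=; rewrite Alls_cat IH. Qed.

Lemma Alls_nth (A : Type) (a0 : A) (P : A -> Prop) (l : seq A) :
  Alls P l <-> forall i, (i < size l)%N -> P (nth a0 l i).
Proof.
elim: l => [|a l IH] /=; first by split.
rewrite IH; split=> [[Pa h] [|i] //= il|h]; first exact: h.
by split=> [|i il]; [apply: (h 0)|apply: (h i.+1)].
Qed.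

Lemma size_flatten_le (A : Type) (k : nat) (ls : seq (seq A)) :
  Alls (fun l => size l <= k)%N ls -> (size (flatten ls) <= size ls * k)%N.
Proof.
elim: ls => [|l ls IH] //= [lk /IH h].
by rewrite size_cat mulSn leq_add.
Qed.

(** This is where NATP is used.  Take parallel copies of trees of the tower, one
    for each letter of a word containing all the words to be controlled.  They
    form a tree for the conjunction of copies of [psi] whose antichains are
    consistent, so some pair of comparable nodes [nu], [nu'] is satisfiable in all
    copies at once.  The trees of blocks built on this one pair satisfy the words
    again, since the type of the pair at ([nu], [nu']) in a cone depends on the level
    of the cone only; and [uphalf c] blocks on a branch contain [c] old nodes. *)
Lemma double_towers (n m : nat) (psi : formula L ('I_n + 'I_m)) c :
  NATP U -> admits_towers psi c -> admits_towers (double psi) (uphalf c).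
Proof.
move=> natp tow D s.
(* contains all words of length at most [s] in the letters [1], ..., [D] *)
pose gs := flatten (nseq s (iota 1 D)); pose N := size gs.
have gsD g : g \in gs -> (0 < g <= D)%N.
  by move=> /flattenP[r]; rewrite mem_nseq => /andP[_ /eqP->]; rewrite mem_iota.
pose psiN : formula L ('I_n + ('I_N * 'I_m)%type) :=
  Ands [seq rename (glue inl (fun y => inr (i, y))) psi | i <- enum 'I_N].
have sat_psiN (x : 'I_n -> U) (a : 'I_N * 'I_m -> U) : sat psiN (glue x a) <->
    forall i, sat psi (glue x (fun y => a (i, y))).
  have E i : sat (rename (glue inl (fun y => inr (i, y))) psi) (glue x a)
      <-> sat psi (glue x (fun y => a (i, y))).
    rewrite sat_rename; suff -> : glue x a \o glue inl (fun y => inr (i, y))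
      = glue x (fun y => a (i, y)) by [].
    by apply: funext => -[].
  rewrite sat_Ands Alls_map AllsP; split=> h i; last by move=> _; apply/E.
  by apply/E; apply: h; rewrite mem_enum.
have [h hP] := NATP_height hU psiN natp.
have [G [tG wG cG]] := tow (h * D)%N (N * 2 ^ h)%N.
have gG := tG.1.
have gG_all hs : Alls (@generic _) [seq G g | g <- hs].
  by elim: hs => //= g hs; split.
have [Bs gBs] : exists Bs, gens M [seq G (h * g)%N | g <- gs] Bs.
  have -> : [seq G (h * g)%N | g <- gs] = [seq G g | g <- [seq h * g | g <- gs]]%N.
    by rewrite -map_comp.
  exact: gens_ex (small_tree m) (gG_all _) _ M_small.
have sBs : size Bs = N by rewrite -(gens_size gBs) size_map.
have [u0] := carrier_inhabited U.
pose B i := nth (fun=> u0) Bs i.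
(* an antichain gives a word of length at most [N * 2 ^ h] *)
have [nu [nu' [/prefixP[w wE] nn hnu' [x0 [x1 x2]]]]] :
    exists nu nu', [/\ prefix nu nu', nu <> nu', (size nu' < h)%N &
      exists x : 'I_n -> U,
        sat psiN (glue x (fun iy => B (val iy.1) (nu, iy.2))) /\
        sat psiN (glue x (fun iy => B (val iy.1) (nu', iy.2)))].
  apply: (hP (fun nu iy => B (val iy.1) (nu, iy.2))) => l l_anti l_h.
  pose X : pred (seq bool) := mem l.
  have [x xP] : satisfiable psi
      (flatten [seq [seq node B nu | nu <- lexl h X] | B <- Bs]).
    apply: (wG (flatten [seq [seq (g - size nu)%N | nu <- lexl h X]
        | g <- [seq h * g | g <- gs]]%N)).
    - have -> : N = size [seq [seq (g - size nu)%N | nu <- lexl h X]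
          | g <- [seq h * g | g <- gs]]%N by rewrite !size_map.
      apply: size_flatten_le; apply/Alls_map/AllsP => g _ /=.
      by rewrite size_map size_lexl.
    - move=> g /flattenP[r] /mapP[_ /mapP[g' /gsD/andP[g'0 g'D] ->] ->].
      move=> /mapP[eta /lexl_size eta_h ->].
      rewrite subn_gt0 (leq_trans eta_h) ?leq_pmulr //=.
      by apply: leq_trans (leq_subr _ _) _; rewrite leq_mul2l g'D orbT.
    - refine (@gens_parallel m _ G h X [seq h * g | g <- gs]%N M Bs tG _ _ _) => //;
        last by rewrite -map_comp.
      move=> _ /mapP[g /gsD/andP[g0 gD] ->].
      by rewrite leq_pmulr //= leq_mul2l gD orbT.
  exists x; apply/AllsP => eta eta_l; apply/sat_psiN => i /=.
  move/Alls_flatten/(Alls_nth (fun=> u0)): xP => /(_ (val i)).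
  rewrite sBs => /(_ (ltn_ord i)) /Alls_map/AllsP /(_ eta); apply.
  by apply: mem_lexl => //; apply: l_h.
(* every new step descends exactly [h] levels of the old tree *)
pose kappa := nu' ++ nseq (h.-1 - size nu') false.
have h_gt0 : (0 < h)%N by apply: leq_ltn_trans hnu'.
have skappa : (size kappa).+1 = h.
  rewrite size_cat size_nseq subnKC ?prednK //.
  by rewrite -ltnS prednK.
have [m0] := elementary_inhabited M_elem.
pose bl (g : nat) := @blocks m nu nu' kappa m0 g.
pose G' (g : nat) (E : set U) (B' : seq bool * 'I_(m + m) -> U) :=
  exists2 B1, G (h * g)%N E B1 & B' = bl g B1.
have gG' g : generic (G' g).
  exact: (generic_reindex (block_var nu nu' kappa m0 g) (small_tree m) (gG _)).
have root_range g B1 : range (node (bl g B1) [::]) `<=` range B1 `|` M.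
  by move=> z [y _ <-]; apply: (@range_blocks _ nu nu' kappa m0 g); exists ([::], y).
exists G'; split.
- split=> [//|g E _ gD ME [B1 GB ->]]; rewrite /bl !cone_blocks.
  have hg : (h * g.+1 = (h * g).+1 + size kappa)%N.
    by rewrite mulnS -skappa addSnnS addnC.
  have hgD : (h * g.+1 <= h * D)%N by rewrite leq_mul2l gD orbT.
  have GC : G (h * g).+1%N E (cone kappa B1).
    by apply: (tower_cone tG); rewrite -?hg.
  have [|G0 G1] := tG.2 _ _ _ _ ME GC.
    by apply: leq_trans hgD; rewrite hg leq_addr.
  rewrite !cone_cone !cats1 in G0 G1; split.
    by exists (cone (rcons kappa false) B1).
  exists (cone (rcons kappa true) B1) => //; apply: (generic_mono (gG _)) G1.
  by move=> z [Ez|/range_blocks[?|/ME ?]]; [left|right|left].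
- move=> ns l ns_s nsD gl.
  pose roots := [seq node (bl 1 B1) [::] | B1 <- Bs].
  have groots gs' E Bs' : (forall g, g \in gs' -> 0 < g)%N -> M `<=` E ->
      gens E [seq G (h * g)%N | g <- gs'] Bs' ->
      gens E [seq at_node [::] (G' g) | g <- gs']
        [seq node (bl 1 B1) [::] | B1 <- Bs'].
    elim: gs' E Bs' => [|g gs' IH] E [|B1 Bs'] //= gs0 ME [GB gBs']; split.
      exists (bl g B1); first by exists B1.
      by have := gs0 g; rewrite inE eqxx => /(_ isT); case: (g).
    apply: (gens_mono (E := E `|` range B1)).
    + by elim: (gs') => //= g' gs'' IHg; split=> //; exact: generic_node.
    + by move=> z [Ez|/root_range[?|/ME ?]]; [left|right|left].
    + apply: IH => // [g' g'gs|z /ME]; last by left.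
      by apply: gs0; rewrite inE g'gs orbT.
  have {}groots : gens M [seq at_node [::] (G' g) | g <- gs] roots.
    by apply: groots => // g /gsD/andP[].
  have /subseqP[b _ ns_b] := subseq_repeat ns_s nsD.
  have gGs : Alls (@generic _) [seq at_node [::] (G' g) | g <- gs].
    by elim: (gs) => //= g' gs'' IHg; split=> //; exact: generic_node.
  have := gens_mask b gGs groots; rewrite -map_mask -ns_b => gl'.
  have [||s1 [s1A _ <-]] := gens_uniq (small_countable K_nat _) _ _ M_small gl' gl.
  + by elim: (ns) => //= g' gs'' IHg; split=> //; exact: generic_node.
  + by [].
  exists (s1 \o x0); apply/Alls_map.
  have : Alls (fun a => sat (double psi) (glue x0 a)) (mask b roots).
    apply/Alls_mask/Alls_map/(Alls_nth (fun=> u0)) => i; rewrite sBs => iN /=.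
    have [E1 E2] := @node_blocks _ nu nu' kappa m0 1 (nth (fun=> u0) Bs i) [::] isT.
    apply/sat_double; rewrite E1 E2.
    by split; [exact: (sat_psiN _ _).1 x1 (Ordinal iN)|
               exact: (sat_psiN _ _).1 x2 (Ordinal iN)].
  apply: Alls_impl => a; rewrite -(sat_aut _ (glue x0 a) s1A).
  suff -> : s1 \o glue x0 a = glue (s1 \o x0) (s1 \o a) by [].
  by apply: funext => -[].
- move=> g _ l gD [B1 GB ->] cl lp lg /satisfiable_double.
  pose l2 := flatten [seq [:: path_to kappa eta ++ nu; path_to kappa eta ++ nu']
    | eta <- l].
  have -> : flatten [seq [:: a \o @lshift m m; a \o @rshift m m]
      | a <- [seq node (bl g B1) eta | eta <- l]] = [seq node B1 eta | eta <- l2].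
    rewrite /l2; elim: l lg {cl lp l2} => [|eta l IH] //= lg.
    have [|E1 E2] := @node_blocks _ nu nu' kappa m0 g B1 eta.
      by apply: lg; rewrite inE eqxx.
    rewrite E1 E2 IH // => eta' eta'l; apply: lg; by rewrite inE eta'l orbT.
  apply: (cG (h * g)%N B1 l2) => //.
  + by rewrite leq_mul2l gD orbT.
  + have -> : size l2 = (size l).*2.
      by rewrite /l2; elim: (l) => //= eta l' ->.
    apply: leq_trans (_ : (uphalf c).*2 <= _)%N; last by rewrite leq_double.
    by rewrite -[X in (X <= _)%N]odd_double_half uphalf_half doubleD leq_add2r;
       case: (odd c).
  + rewrite /l2; elim: l lp {cl lg l2} => //= eta l IH /andP[/allP lp /IH {}IH].
    have pp : sprefix (path_to kappa eta ++ nu) (path_to kappa eta ++ nu').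
      rewrite /sprefix wE catA prefix_prefix /= -{1}[_ ++ nu]cats0 eqseq_cat // eqxx.
      by case: w wE => // /[!cats0] wE; case: nn.
    have p_all : all (sprefix (path_to kappa eta ++ nu'))
        (flatten [seq [:: path_to kappa eta0 ++ nu; path_to kappa eta0 ++ nu']
           | eta0 <- l]).
      apply/allP => z /flattenP[_ /mapP[eta' /lp/sprefixP[b [v ->]] ->]].
      have [b' [v' E]] : exists b' v', kappa ++ b :: path_to kappa v = nu' ++ b' :: v'.
        rewrite /kappa -catA.
        by case: (_ - _)%N => [|k]; [exists b|exists false]; eexists.
      have Ez t : path_to kappa (eta ++ b :: v) ++ t
          = (path_to kappa eta ++ nu') ++ b' :: (v' ++ t).
        by rewrite path_to_cat /= E -!catA.
      by rewrite !inE !Ez => /orP[] /eqP->; apply/sprefixP; eexists; eexists.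
    rewrite pp IH p_all !andbT /=.
    by apply: sub_all p_all => z; apply: sprefix_trans pp.
  + move=> z /flattenP[_ /mapP[eta /lg eta_g ->]].
    have zlt t : (size t < h)%N -> (size (path_to kappa eta ++ t) < h * g)%N.
      move=> th; rewrite size_cat size_path_to skappa.
      by apply: leq_trans (_ : size eta * h + h <= _)%N;
        rewrite ?ltn_add2l // -mulSnr mulnC leq_mul2l eta_g orbT.
    rewrite !inE => /orP[] /eqP->; apply: zlt => //.
    by apply: leq_ltn_trans hnu'; rewrite wE size_cat leq_addr.
Qed.

(** Halving [c] ends with [c <= 1], where a single node would be both satisfiable and
    unsatisfiable. *)
Lemma no_towers (n m : nat) (psi : formula L ('I_n + 'I_m)) c :
  NATP U -> ~ admits_towers psi c.
Proof.
move=> natp; elim: c {-2}c (leqnn c) m psi => [|k IH] c ck m psi tow.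
  have [G [tG wG cG]] := tow 1 1.
  have [B GB] := generic_ex (tG.1 1) (@subset_refl _ M) M_small.
  apply: (cG 1 B [::]) => //.
  by have [x] := carrier_inhabited U; exists (fun=> x).
have [c1|c1] := leqP c 1; last first.
  apply: (IH (uphalf c) _ _ _ (double_towers natp tow)).
  rewrite -ltnS; apply: leq_trans ck; case: c c1 {tow} => [|[|c]] // _.
  by rewrite /= !ltnS leq_uphalf_double -addnn leq_addl.
have [G [tG wG cG]] := tow 1 1.
have [B GB] := generic_ex (tG.1 1) (@subset_refl _ M) M_small.
apply: (cG 1 B [:: [::]]) => //; first by move=> eta; rewrite inE => /eqP->.
apply: (wG [:: 1]) => //; first by move=> g; rewrite inE => /eqP->.
by split=> //; exists B.
Qed.

(** * Coheirs as ultrafilters *)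

(** An ultrafilter on the tuples of [M] determines a global type finitely
    satisfiable in [M], and every coheir over [M] arises in this way.  Products and
    images of ultrafilters give independent pairs and subtuples, and there are few
    ultrafilters, which bounds the number of coheirs. *)
Definition Mt (I : Type) : Type := I -> {c | M c}.

Definition real (I : Type) (F : set_system (Mt I)) (E : set U) (A : I -> U) : Prop :=
  forall (P : Type) (phi : formula L (I + P)) (e : P -> U), (forall p, E (e p)) ->
    sat phi (glue A e) <-> F [set m : Mt I | sat phi (glue (sval \o m) e)].

Lemma ultraP (A : Type) (F : set_system A) :
  UltraFilter F <-> ProperFilter F /\ forall X, F X \/ F (~` X).
Proof.
split=> [uF|[pF FX]]; first by split=> [|X]; [exact: ultra_proper|
  exact: in_ultra_setVsetC].
split=> // G pG FG; apply/seteqP; split=> // X GX.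
have [//|/FG GcX] := FX X; suff : G set0 by move/(@filter_not_empty _ _ pG).
by rewrite -(setICr X); apply: filterI.
Qed.

Lemma ultra_not (A : Type) (F : set_system A) (X : set A) :
  UltraFilter F -> F (~` X) <-> ~ F X.
Proof.
move=> uF; split=> [FcX FX|nFX]; last by have [//|] := in_ultra_setVsetC X uF.
by apply: (@filter_not_empty _ F _); rewrite -(setICr X); apply: filterI.
Qed.

Lemma ultra_fmap (A B : Type) (f : A -> B) (F : set_system A) :
  UltraFilter F -> UltraFilter (fmap f F).
Proof.
move=> uF; apply/ultraP; split; first exact: fmap_proper_filter.
by move=> X; apply: (in_ultra_setVsetC (f @^-1` X) uF).
Qed.

Lemma ultra_eq (A : Type) (F F' : set_system A) :
  UltraFilter F -> UltraFilter F' -> F `<=` F' -> F' = F.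
Proof. by move=> uF uF' FF'; apply: max_filter => //; exact: ultra_proper. Qed.

Lemma generic_real (I : Type) (F : set_system (Mt I)) :
  Small I -> UltraFilter F -> generic (real F).
Proof.
move=> sI uF; split=> [E ME sE|s E E' A sA sM sE FA P phi e eE'|E A A' ME sE FA FA'].
- pose p : set (pformula I) := [set phi | forms_over E phi /\
    F [set m : Mt I | psat (sval \o m) phi]].
  have [||phi []|n phi phip|A Ap] // := @monster_saturated _ _ _ _ hU I E p.
    have : F [set m : Mt I | forall k, psat (sval \o m) (phi k)].
      have -> : [set m : Mt I | forall k, psat (sval \o m) (phi k)]
        = [set m | forall k, [set m : Mt I | psat (sval \o m) (phi k)] m] by [].
      by apply: filter_forall => k; case: (phip k).
    by move=> /filter_ex[m mP]; exists (sval \o m).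
  exists A => P phi e eE.
  pose e' p : {c | E c} := exist _ (e p) (eE p).
  have psatE a : psat a (subst (rename (glue inl (inr \o e')) phi) sval)
      <-> sat phi (glue a e).
    rewrite /psat !sat_rename.
    suff -> : (glue a id \o glue inl (inr \o sval)) \o glue inl (inr \o e')
      = glue a e by [].
    by apply: funext => -[].
  have h : (F [set m : Mt I | sat phi (glue (sval \o m) e)]) <->
      F [set m : Mt I | psat (sval \o m)
        (subst (rename (glue inl (inr \o e')) phi) sval)].
    suff -> : [set m : Mt I | psat (sval \o m) (subst (rename (glue inl
      (inr \o e')) phi) sval)] = [set m : Mt I | sat phi (glue (sval \o m) e)] by [].
    by apply/seteqP; split=> m /psatE.
  split=> [sphi|/h Fphi]; last by apply/psatE/Ap; split=> //; eexists.
  apply: contrapT => /h/(ultra_not _ uF).2 nF.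
  have : psat A (Not (subst (rename (glue inl (inr \o e')) phi) sval)).
    apply: Ap; split=> //.
    by exists (Not (rename (glue inl (inr \o e')) phi)).
  by apply; apply/psatE.
- have [d dP] := choice (fun p => let: ex_intro2 d h1 h2 := sE _ (eE' p) in
    ex_intro (fun d => E d /\ s d = e p) d (conj h1 h2)).
  have ed : e = s \o d by apply: funext => p; rewrite /= (dP p).2.
  have -> : glue (s \o A) e = s \o glue A d by rewrite ed; apply: funext => -[].
  rewrite (sat_aut _ _ sA) (FA _ _ _ (fun p => (dP p).1)).
  suff -> : [set m : Mt I | sat phi (glue (sval \o m) d)]
      = [set m : Mt I | sat phi (glue (sval \o m) e)] by [].
  have E0 (m : Mt I) : glue (sval \o m) e = s \o glue (sval \o m) d.
    by rewrite ed; apply: funext => -[i|//] /=; rewrite sM //; apply: svalP.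
  by apply/seteqP; split=> m /=; rewrite E0 (sat_aut _ _ sA).
- apply: equiv_aut => //; apply/equivP => P phi e eE.
  by rewrite (FA _ _ _ eE) (FA' _ _ _ eE).
Qed.

Definition Mt_map (I I' : Type) (f : I' -> I + {c | M c}) (m : Mt I) : Mt I' :=
  glue m id \o f.

Lemma real_map (I I' : Type) (f : I' -> I + {c | M c}) F E A :
  M `<=` E -> real F E A -> real (fmap (Mt_map f) F) E (glue A sval \o f).
Proof.
move=> ME FA P phi e eE.
pose r v : I + ({c | M c} + P) := match v with
  | inl i => match f i with inl j => inl j | inr c => inr (inl c) end
  | inr p => inr (inr p) end.
have r_map a : glue a (glue sval e) \o r = glue (glue a sval \o f) e.
  by apply: funext => -[i|p] //=; case: (f i).
have eE' v : E (glue (sval : {c | M c} -> U) e v).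
  by case: v => [c|p] /=; [apply/ME/svalP|exact: eE].
rewrite -r_map -sat_rename (FA _ _ _ eE').
suff -> : [set m : Mt I | sat (rename r phi) (glue (sval \o m) (glue sval e))]
    = Mt_map f @^-1` [set m : Mt I' | sat phi (glue (sval \o m) e)] by [].
have E0 (m : Mt I) : glue (sval \o Mt_map f m) e
    = glue (sval \o m) (glue sval e) \o r.
  by apply: funext => -[i|p] //=; rewrite /Mt_map /=; case: (f i).
by apply/seteqP; split=> m /=; rewrite E0 sat_rename.
Qed.

Lemma ultra_base (A : Type) (B : set_system A) :
  (exists X, B X) -> (forall X, B X -> exists a, X a) ->
  (forall X Y, B X -> B Y -> exists2 Z, B Z & Z `<=` X `&` Y) ->
  exists2 F : set_system A, UltraFilter F & B `<=` F.
Proof.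
move=> [X0 BX0] B0 BI.
have [|F [uF BF]] := @ultraFilterLemma _ (filter_from B id).
  apply: filter_from_proper => [|X /B0[a Xa]]; last by exists a.
  by apply: filter_from_filter; [exists X0|exact: BI].
by exists F => // X BX; apply: BF; exists X.
Qed.

Lemma sat_and (V : Type) (e : V -> U) (phi psi : formula L V) :
  sat (Ands [:: phi; psi]) e <-> sat phi e /\ sat psi e.
Proof. by rewrite sat_Ands /=; tauto. Qed.

Lemma inhabited_Mt (I : Type) : exists m : Mt I, True.
Proof. by have [c] := elementary_inhabited M_elem; exists (fun=> c). Qed.

Lemma coheir_ultra (I : Type) (E : set U) (A : I -> U) : M `<=` E ->
  (forall (phi : formula L (I + {c | E c})), sat phi (glue A sval) ->
     exists m : Mt I, sat phi (glue (sval \o m) sval)) ->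
  exists2 F : set_system (Mt I), UltraFilter F & real F E A.
Proof.
move=> ME fs.
pose B : set_system (Mt I) := [set X | exists2 phi : formula L (I + {c | E c}),
  sat phi (glue A sval) & X = [set m : Mt I | sat phi (glue (sval \o m) sval)]].
have [||X Y [phi sphi ->] [psi spsi ->]|F uF BF] := @ultra_base _ B.
- by eexists; exists (Not Bot).
- by move=> X [phi /fs[m sm] ->]; exists m.
- exists [set m : Mt I | sat (Ands [:: phi; psi]) (glue (sval \o m) sval)].
    by exists (Ands [:: phi; psi]) => //; apply/sat_and.
  by move=> m /sat_and.
exists F => // P phi e eE.
pose e' p : {c | E c} := exist _ (e p) (eE p).
pose phi' : formula L (I + {c | E c}) := rename (glue inl (inr \o e')) phi.
have E0 a : sat phi' (glue a sval) <-> sat phi (glue a e).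
  rewrite sat_rename; suff -> : glue a sval \o glue inl (inr \o e') = glue a e by [].
  by apply: funext => -[].
have FE : F [set m : Mt I | sat phi (glue (sval \o m) e)] <->
    F [set m : Mt I | sat phi' (glue (sval \o m) sval)].
  suff -> : [set m : Mt I | sat phi' (glue (sval \o m) sval)]
    = [set m : Mt I | sat phi (glue (sval \o m) e)] by [].
  by apply/seteqP; split=> m /E0.
rewrite FE -E0; split=> [sphi|Fphi]; first by apply: BF; exists phi'.
apply: contrapT => nphi.
suff : F (~` [set m : Mt I | sat phi' (glue (sval \o m) sval)]) by move/ultra_not.
by apply: BF; exists (Not phi').
Qed.

(** Existential quantifiers over [M]-formulas have witnesses in [M], so a formula over
    [M] true of [(A, d)] holds, for [F]-almost all [m], at [(m, m')] for some [m']. *)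
Lemma coheir_extend (I I' : Type) (F : set_system (Mt I)) (A : I -> U) (d : I' -> U) :
  UltraFilter F -> real F M A ->
  exists F' : set_system (Mt (I + I')), [/\ UltraFilter F',
    fmap (fun m : Mt (I + I') => m \o inl : Mt I) F' = F & real F' M (glue A d)].
Proof.
move=> uF FA.
pose B : set_system (Mt (I + I')) := [set X | exists (Z : set (Mt I))
  (phi : formula L ((I + I') + {c | M c})), [/\ F Z, sat phi (glue (glue A d) sval) &
    X = [set m : Mt (I + I') | Z (m \o inl) /\ sat phi (glue (sval \o m) sval)]]].
have [||X Y [Z [phi [FZ sphi ->]]] [Z' [psi [FZ' spsi ->]]]|F' uF' BF] :=
    @ultra_base _ B.
- by eexists; exists setT, (Not Bot); split=> //; apply: filterT.
- move=> _ [Z [phi [FZ sphi ->]]].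
  pose r : (I + I') + {c | M c} -> (I + {c | M c}) + I' :=
    glue (glue (inl \o inl) inr) (inl \o inr).
  have rE (a : I -> U) (a' : I' -> U) (e : {c | M c} -> U) :
      glue (glue a e) a' \o r = glue (glue a a') e.
    by apply: funext => -[[]|].
  have [psi psiP] := sat_exists (rename r phi).
  have psiE (a : I -> U) : sat psi (glue a sval) <->
      exists y : I' -> U, sat phi (glue (glue a y) sval).
    by rewrite psiP; split=> -[y]; [rewrite sat_rename rE|rewrite -rE -sat_rename];
       exists y.
  have /(FA _ psi sval (fun c => svalP c)).1 Fpsi : sat psi (glue A sval).
    by apply/psiE; exists d.
  have Fboth : F (Z `&` [set m : Mt I | sat psi (glue (sval \o m) sval)]).
    exact: filterI.
  have /filter_ex[m [Zm /psiE[y]]] := Fboth.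
  have -> : glue (glue (sval \o m) y) sval = glue (sval \o glue m id) y \o r.
    by apply: funext => -[[]|].
  rewrite -sat_rename => /(elementary_exists M_elem)[m']; rewrite sat_rename => h.
  exists (glue m m'); split; first by suff -> : glue m m' \o inl = m by [].
  suff <- : glue (sval \o glue m id) (sval \o m') \o r
    = glue (sval \o glue m m') sval by [].
  by apply: funext => -[[]|].
- exists [set m : Mt (I + I') | (Z `&` Z') (m \o inl) /\
      sat (Ands [:: phi; psi]) (glue (sval \o m) sval)].
    exists (Z `&` Z'), (Ands [:: phi; psi]); split=> //; first exact: filterI.
    exact/sat_and.
  by move=> m [[? ?] /sat_and[]].
exists F'; split=> //.
  apply: ultra_eq => //; first exact: ultra_fmap.
  move=> Z FZ; apply: BF; exists Z, (Not Bot); split=> //.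
  by apply/seteqP; split=> m //= [].
move=> P phi e eM.
pose e' p : {c | M c} := exist _ (e p) (eM p).
pose phi' : formula L ((I + I') + {c | M c}) := rename (glue inl (inr \o e')) phi.
have E0 a : sat phi' (glue a sval) <-> sat phi (glue a e).
  rewrite sat_rename; suff -> : glue a sval \o glue inl (inr \o e') = glue a e by [].
  by apply: funext => -[].
have F'phi (psi : formula L ((I + I') + {c | M c})) : sat psi (glue (glue A d) sval) ->
    F' [set m : Mt (I + I') | sat psi (glue (sval \o m) sval)].
  move=> spsi; apply: BF; exists setT, psi; split=> //; first exact: filterT.
  by apply/seteqP; split=> m //= [].
have FE : F' [set m : Mt (I + I') | sat phi (glue (sval \o m) e)] <->
    F' [set m : Mt (I + I') | sat phi' (glue (sval \o m) sval)].
  suff -> : [set m : Mt (I + I') | sat phi' (glue (sval \o m) sval)]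
    = [set m : Mt (I + I') | sat phi (glue (sval \o m) e)] by [].
  by apply/seteqP; split=> m /E0.
rewrite FE -E0; split=> [/F'phi //|Fphi]; apply: contrapT => nphi.
suff : F' (~` [set m : Mt (I + I') | sat phi' (glue (sval \o m) sval)]).
  by move/ultra_not.
exact: (F'phi (Not phi')).
Qed.

(** A coheir of the subtuple of [d] named by [f] extends to a coheir of [d].  The
    subtuple is finite so that the equations naming it, which are formulas, hold
    simultaneously for almost all tuples of [M]. *)
Lemma coheir_lift (I : finType) (I' : Type) (f : I -> I' + {c | M c})
    (F : set_system (Mt I)) (d : I' -> U) :
  UltraFilter F -> real F M (glue d sval \o f) ->
  exists F' : set_system (Mt I'), [/\ UltraFilter F',
    fmap (Mt_map f) F' = F & real F' M d].
Proof.
move=> uF FA; have [R [uR RF RA]] := coheir_extend d uF FA.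
pose g : I' -> (I + I') + {c | M c} := inl \o inr.
exists (fmap (Mt_map g) R); split; first exact: ultra_fmap.
- apply: ultra_eq => //; first by do 2 apply: ultra_fmap.
  move=> Z; rewrite -{1}RF => FZ.
  have RZ : R [set m : Mt (I + I') | Z (m \o inl)] by exact: FZ.
  have Req : R [set m | forall i, [set m : Mt (I + I') |
      sval (m (inl i)) = glue (sval \o (m \o inr)) sval (f i)] m].
    apply: filter_forall => i.
    pose v : (I + I') + {c | M c} := match f i with
      | inl j => inl (inr j) | inr c => inr c end.
    have := (RA _ (Eq (Var _ (inl (inl i))) (Var _ v)) sval (fun c => svalP c)).1.
    have vE (a : I + I' -> U) : glue a sval v = glue (a \o inr) sval (f i).
      by rewrite /v; case: (f i).
    rewrite /= vE => /(_ erefl); apply: filterS => m /=; rewrite vE //.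
  change (R [set m | Z (Mt_map f (Mt_map g m))]).
  apply: (filterS _ (filterI RZ Req)) => m [/= Zm mf].
  suff -> : Mt_map f (Mt_map g m) = m \o inl by [].
  apply: funext => i; apply: sval_inj; rewrite [in RHS]/= mf /Mt_map /=.
  by case: (f i).
- have := real_map g (@subset_refl _ M) RA.
  by suff -> : glue (glue (glue d sval \o f) d) sval \o g = d by [].
Qed.

Definition prodF (I I' : Type) (F : set_system (Mt I)) (F' : set_system (Mt I')) :
    set_system (Mt (I + I')) :=
  [set Z | F' [set m' | F [set m | Z (glue m m')]]].

Lemma ultra_prodF I I' (F : set_system (Mt I)) (F' : set_system (Mt I')) :
  UltraFilter F -> UltraFilter F' -> UltraFilter (prodF F F').
Proof.
move=> uF uF'; apply/ultraP; split; last first.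
  move=> Z; have [|h] := in_ultra_setVsetC [set m' | F [set m | Z (glue m m')]] uF'.
    by left.
  by right; apply: filterS h => m' /= nF; apply/ultra_not.
split; rewrite /prodF /=.
  have -> : [set m' : Mt I' | F [set m : Mt I | set0 (glue m m')]] = set0.
    by apply/seteqP; split=> m' //= /(@filter_not_empty _ F _).
  exact: filter_not_empty.
split=> [|X Y FX FY|X Y XY FX].
- change (F' [set m' : Mt I' | F [set m : Mt I | [set: Mt (I + I')] (glue m m')]]).
  have -> : [set m' : Mt I' | F [set m : Mt I | [set: Mt (I + I')] (glue m m')]]
      = setT by apply/seteqP; split=> // m' _; apply: filterT.
  exact: filterT.
- have FX' : F' [set m' : Mt I' | F [set m : Mt I | X (glue m m')]] by [].
  have FY' : F' [set m' : Mt I' | F [set m : Mt I | Y (glue m m')]] by [].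
  change (F' [set m' : Mt I' | F [set m : Mt I | (X `&` Y) (glue m m')]]).
  apply: (filterS _ (filterI FX' FY')) => m' [FXm FYm].
  exact: (filterI FXm FYm).
- have FX' : F' [set m' : Mt I' | F [set m : Mt I | X (glue m m')]] by [].
  change (F' [set m' : Mt I' | F [set m : Mt I | Y (glue m m')]]).
  apply: (filterS _ FX') => m' FXm.
  by apply: (filterS _ FXm) => m; apply: XY.
Qed.

(** The tuple on the right is the one realizing its type over the other, so its
    quantifier is the outer one. *)
Lemma real_prodF I I' (F : set_system (Mt I)) (F' : set_system (Mt I')) E A A' :
  M `<=` E -> real F E A -> real F' (E `|` range A) A' ->
  real (prodF F F') E (glue A A').
Proof.
move=> ME FA F'A' P phi e eE.
pose r : (I + I') + P -> I' + (I + P) := glue (glue (inr \o inl) inl) (inr \o inr).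
have rE (a : I -> U) (a' : I' -> U) : glue (glue a a') e = glue a' (glue a e) \o r.
  by apply: funext => -[[]|].
pose q : (I + I') + P -> I + (I' + P) := glue (glue inl (inr \o inl)) (inr \o inr).
have qE (a : I -> U) (a' : I' -> U) : glue (glue a a') e = glue a (glue a' e) \o q.
  by apply: funext => -[[]|].
rewrite rE -sat_rename (F'A' _ _ _) => [|[i|p] /=]; last 2 first.
- by right; exists i.
- by left; apply: eE.
suff -> : [set m' : Mt I' | sat (rename r phi) (glue (sval \o m') (glue A e))]
  = [set m' : Mt I' | F [set m : Mt I | sat phi (glue (sval \o glue m m') e)]] by [].
apply/seteqP; split=> m' /=.
all: have E0 (m : Mt I) : glue (sval \o glue m m') e
  = glue (sval \o m) (glue (sval \o m') e) \o q by rewrite -qE;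
  congr glue; apply: funext => -[].
all: have E1 : [set m : Mt I | sat phi (glue (sval \o glue m m') e)]
  = [set m : Mt I | sat (rename q phi) (glue (sval \o m) (glue (sval \o m') e))]
  by apply/seteqP; split=> m /=; rewrite E0 sat_rename.
all: rewrite E1 -(FA _ (rename q phi) (glue (sval \o m') e));
  [|by case=> [i|p] /=; [apply/ME/svalP|apply: eE]].
all: by rewrite !sat_rename -rE -qE.
Qed.

Lemma prodF_real I I' (F : set_system (Mt I)) (F' : set_system (Mt I')) E A A' :
  UltraFilter F -> UltraFilter F' -> M `<=` E -> real (prodF F F') E (glue A A') ->
  real F E A /\ real F' (E `|` range A) A'.
Proof.
move=> uF uF' ME FAA'.
have FA : real F E A.
  move=> P phi e eE; pose r : I + P -> (I + I') + P := glue (inl \o inl) inr.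
  have rE a a' : glue (glue a a') e \o r = glue a e by apply: funext => -[].
  have := FAA' _ (rename r phi) e eE; rewrite sat_rename rE => ->; rewrite /prodF /=.
  set X := [set m : Mt I | sat phi (glue (sval \o m) e)].
  have -> : [set m' : Mt I' | F [set m : Mt I |
      sat (rename r phi) (glue (sval \o glue m m') e)]] = [set m' | F X].
    have E0 m' : [set m : Mt I | sat (rename r phi) (glue (sval \o glue m m') e)] = X.
      have E1 (m : Mt I) : glue (sval \o glue m m') e \o r = glue (sval \o m) e.
        by apply: funext => -[].
      by apply/seteqP; split=> m /=; rewrite sat_rename E1.
    by apply/seteqP; split=> m' /=; rewrite E0.
  split=> [/filter_ex[]//|FX].
  have -> : [set m' : Mt I' | F X] = setT by apply/seteqP; split.
  exact: filterT.
split=> // P phi e eE.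
have exr p : exists v : I + {c | E c}, glue A sval v = e p.
  have [Ep|[i _ Ai]] := eE p; last by exists (inl i).
  by exists (inr (exist _ _ Ep)).
have [r rP] := choice exr.
pose q : I' + P -> (I + I') + {c | E c} :=
  glue (inl \o inr) (glue (inl \o inl) inr \o r).
pose q' : I' + P -> I + (I' + {c | E c}) :=
  glue (inr \o inl) (glue inl (inr \o inr) \o r).
have qE (a : I -> U) (a' : I' -> U) : glue (glue a a') sval \o q
    = glue a' (glue a sval \o r).
  by apply: funext => -[//|p] /=; case: (r p).
have q'E (a : I -> U) (a' : I' -> U) : glue a (glue a' sval) \o q'
    = glue a' (glue a sval \o r).
  by apply: funext => -[//|p] /=; case: (r p).
have -> : e = glue A sval \o r by apply: funext => p; rewrite /= rP.
rewrite -qE -sat_rename (FAA' _ _ _ (fun c => svalP c)) /prodF /=.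
suff -> : [set m' : Mt I' | F [set m : Mt I |
    sat (rename q phi) (glue (sval \o glue m m') sval)]]
  = [set m' : Mt I' | sat phi (glue (sval \o m') (glue A sval \o r))] by [].
have E0 m' : F [set m : Mt I | sat (rename q phi) (glue (sval \o glue m m') sval)]
    <-> sat phi (glue (sval \o m') (glue A sval \o r)).
  rewrite -q'E -sat_rename (FA _ (rename q' phi) (glue (sval \o m') sval)); last first.
    by case=> [i|c] /=; [apply/ME/svalP|apply: svalP].
  suff -> : [set m : Mt I | sat (rename q phi) (glue (sval \o glue m m') sval)]
    = [set m : Mt I | sat (rename q' phi) (glue (sval \o m) (glue (sval \o m') sval))].
    by [].
  have E1 (m : Mt I) : sval \o glue m m' = glue (sval \o m) (sval \o m').
    by apply: funext => -[].
  by apply/seteqP; split=> m /=; rewrite !sat_rename E1 qE q'E.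
by apply/seteqP; split=> m' /E0.
Qed.

(** * Global types, and reduction to finite tuples *)

Definition typ (I : Type) (F : set_system (Mt I)) : set (pformula I) :=
  [set phi | F [set m : Mt I | psat (sval \o m) phi]].

Definition gtype (I : Type) (p : set (pformula I)) : set U -> (I -> U) -> Prop :=
  fun E a => realizes a (p `&` forms_over E).

Lemma psat_subst (I P : Type) (phi : formula L (I + P)) (e : P -> U) (a : I -> U) :
  psat a (subst phi e) <-> sat phi (glue a e).
Proof.
rewrite /psat sat_rename; suff -> : glue a id \o glue inl (inr \o e) = glue a e by [].
by apply: funext => -[].
Qed.

Lemma subst_over (I P : Type) (phi : formula L (I + P)) (e : P -> U) (E : set U) :
  (forall p, E (e p)) -> exists2 phi' : formula L (I + {c | E c}),
    forms_over E (subst phi' sval) &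
    forall a : I -> U, psat a (subst phi' sval) <-> sat phi (glue a e).
Proof.
move=> eE; pose e' p : {c | E c} := exist _ (e p) (eE p).
exists (rename (glue inl (inr \o e')) phi); first by eexists.
move=> a; rewrite psat_subst sat_rename.
suff -> : glue a sval \o glue inl (inr \o e') = glue a e by [].
by apply: funext => -[].
Qed.

Lemma typ_subst (I P : Type) (F : set_system (Mt I)) (phi : formula L (I + P)) e :
  typ F (subst phi e) <-> F [set m : Mt I | sat phi (glue (sval \o m) e)].
Proof.
suff -> : [set m : Mt I | sat phi (glue (sval \o m) e)]
  = [set m : Mt I | psat (sval \o m) (subst phi e)] by [].
by apply/seteqP; split=> m /psat_subst.
Qed.

Lemma gtype_typ (I : Type) (F : set_system (Mt I)) E A :
  UltraFilter F -> gtype (typ F) E A <-> real F E A.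
Proof.
move=> uF; split=> [tA P phi e eE|FA phi [Fphi [psi _ psiE]]]; last first.
  rewrite -psiE; apply/psat_subst/(FA _ _ _ (fun c => svalP c)).
  by apply/typ_subst; rewrite psiE.
have [phi' fphi' phiE] := subst_over phi eE.
have FE : F [set m : Mt I | sat phi (glue (sval \o m) e)] <-> typ F (subst phi' sval).
  rewrite /typ /=; suff -> : [set m : Mt I | psat (sval \o m) (subst phi' sval)]
    = [set m : Mt I | sat phi (glue (sval \o m) e)] by [].
  by apply/seteqP; split=> m /phiE.
rewrite FE -phiE; split=> [sphi|Fphi]; last exact: tA.
apply: contrapT => /(ultra_not _ uF).2 nF.
have : psat A (subst (Not phi') sval).
  by apply: tA; split; [|exists (Not phi')].
by apply.
Qed.

Lemma coheir_typ (I : Type) (F : set_system (Mt I)) :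
  UltraFilter F -> coheir M (typ F).
Proof.
move=> uF n phi Fphi.
have : F [set m | forall k, [set m : Mt I | psat (sval \o m) (phi k)] m].
  by apply: filter_forall => k; apply: Fphi.
move=> /filter_ex[m mP]; exists (sval \o m) => // i; exact: svalP.
Qed.

Lemma global_typ (I : Type) (F : set_system (Mt I)) :
  UltraFilter F -> global_type (typ F).
Proof.
move=> uF; split=> [n phi /(coheir_typ uF)[a _ aP]|phi]; first by exists a.
exact: (in_ultra_setVsetC [set m : Mt I | psat (sval \o m) phi] uF).
Qed.

Lemma invariant_typ (I : Type) (F : set_system (Mt I)) : invariant M (typ F).
Proof.
move=> n phi b b' bb'; rewrite !typ_subst.
suff -> : [set m : Mt I | sat phi (glue (sval \o m) (glue b sval))]
  = [set m : Mt I | sat phi (glue (sval \o m) (glue b' sval))] by [].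
pose r : 'I_n + (I + {c | M c}) -> I + ('I_n + {c | M c}) :=
  glue (inr \o inl) (glue inl (inr \o inr)).
have E (m : Mt I) (b0 : 'I_n -> U) : sat phi (glue (sval \o m) (glue b0 sval)) <->
    sat (rename (glue (inr \o inl) (glue inl (inr \o inr))) phi :
      formula L ('I_n + (I + {c | M c}))) (glue b0 (glue (sval \o m) sval)).
  rewrite sat_rename; suff -> : glue b0 (glue (sval \o m) sval)
      \o glue (inr \o inl) (glue inl (inr \o inr))
    = glue (sval \o m) (glue b0 sval) :> (I + ('I_n + {c | M c}) -> U) by [].
  by apply: funext => -[|[]].
move/equivP: bb' => bb'.
by apply/seteqP; split=> m; rewrite /= !E; apply bb'; case=> c /=; apply: svalP.
Qed.

Lemma tp_typ (I : Type) (F : set_system (Mt I)) (b : I -> U) :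
  UltraFilter F -> real F M b -> tp b M `<=` typ F.
Proof.
move=> uF Fb phi [[psi _ <-] /psat_subst].
by rewrite (Fb _ psi sval (fun c => svalP c)) => Fpsi; apply/typ_subst.
Qed.

Lemma forms_over_mono (I : Type) (E E' : set U) (phi : pformula I) :
  E `<=` E' -> forms_over E phi -> forms_over E' phi.
Proof.
move=> EE' [psi _ <-]; pose incl (c : {c | E c}) : {c | E' c} :=
  exist _ (sval c) (EE' _ (svalP c)).
exists (rename (glue inl (inr \o incl)) psi) => //.
by rewrite /subst rename_rename; congr rename; apply: funext => -[].
Qed.

(** The increasing map [f] accounts for subsequences, hence for indiscernibility. *)
Lemma generated_generic (I : Type) (G : set U -> (I -> U) -> Prop)
    (s : nat -> I -> U) (f : nat -> nat) k :
  (forall E E' a, E' `<=` E -> G E a -> G E' a) ->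
  (forall i, G (M `|` \bigcup_(j in [set j | (j < i)%N]) range (s j)) (s i)) ->
  (forall i j, (i < j < k)%N -> (f i < f j)%N) ->
  gens M (nseq k G) [seq s (f i) | i <- iota 0 k].
Proof.
move=> Gmono sG fI; suff h k' i0 E : (i0 + k' <= k)%N -> (forall i, (i0 <= i < k)%N ->
    E `<=` M `|` \bigcup_(j in [set j | (j < f i)%N]) range (s j)) ->
    gens E (nseq k' G) [seq s (f i) | i <- iota i0 k'].
  by apply: h => // i _ c; left.
elim: k' i0 E => [|k' IH] i0 E //= i0k EM; split.
  apply: Gmono (sG (f i0)); apply: EM; rewrite leqnn /=.
  by apply: leq_trans i0k; rewrite addnS ltnS leq_addr.
apply: IH => [|i /andP[i0i ik] c [Ec|[y _ <-]]]; first by rewrite addSnnS.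
  by apply: EM Ec; rewrite ltnW.
right; exists (f i0); last by exists y.
by apply: fI; rewrite i0i.
Qed.

Lemma consistentP (n : nat) (A : Type) (phi : A -> pformula (U := U) 'I_n) :
  consistent [set phi i | i in [set: A]] <->
  forall l : seq A, exists x : 'I_n -> U, Alls (fun i => psat x (phi i)) l.
Proof.
split=> [h l|h k psi psiP].
  pose psi (j : 'I_(size l)) := phi (tnth (in_tuple l) j).
  have [x _ xP] := h _ psi (fun j => ex_intro2 _ _ (tnth (in_tuple l) j)
    Logic.I erefl).
  exists x; have [->|[a0 _]] : l = [::] \/ exists a : A, True.
  - by case: (l) => [|a]; [left|right; exists a].
  - by [].
  apply/(Alls_nth a0) => i il; have := xP (Ordinal il).
  by rewrite /psi (tnth_nth a0).
have [f fP] := choice (fun j => let: ex_intro2 i _ e := psiP j in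
  ex_intro (fun i => phi i = psi j) i e).
have [x /Alls_map/AllsP xP] := h [seq f j | j <- enum 'I_k].
by exists x => // j; rewrite -fP; apply: xP; rewrite mem_enum.
Qed.

(** Formulas have finitely many parameters, so it does not matter that [invariant]
    speaks of finite tuples only. *)
Lemma invariant_subst (I P : Type) (p : set (pformula I)) (phi : formula L (I + P))
    (e e' : P -> U) :
  global_type p -> invariant M p -> equiv M e e' -> p (subst phi e) ->
  p (subst phi e').
Proof.
move=> [pc pN] pI ee'.
have psem (psi psi' : pformula I) : (forall a, psat a psi <-> psat a psi') ->
    p psi -> p psi'.
  move=> h ppsi; have [//|npsi'] := pN psi'.
  have [a _ aP] := pc 2 (fun j : 'I_2 => if j == ord0 then psi else Not psi')
    (fun j => if j == ord0 as c return p (if c then psi else Not psi')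
              then ppsi else npsi').
  by case: (aP ord_max); apply/h; apply: (aP ord0).
have [c0] := elementary_inhabited M_elem.
have [k [r [t supp]]] := finite_support phi.
pose q : I + P -> I + ('I_k.+1 + {c | M c}) := glue inl (inr \o inl \o r \o inr).
pose e0 (e : P -> U) j : U := oapp (glue (fun=> sval c0) e) (sval c0) (t j).
have E0 (d : P -> U) a : psat a (inst (rename q phi) (e0 d)) <-> psat a (subst phi d).
  rewrite !psat_subst sat_rename; apply: supp => -[//|v] /= tr.
  by rewrite /e0 tr.
move=> /(psem _ _ (fun a => iff_sym (E0 e a))) pe.
apply: (psem _ _ (E0 e')); apply/(pI _ _ _ _ _).1: pe.
have e0r (d : P -> U) : exists g : 'I_k.+1 -> P + {c | M c}, forall d : P -> U,
    e0 d = glue d sval \o g.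
  exists (fun j => match t j with Some (inr v) => inl v | _ => inr c0 end) => d'.
  by apply: funext => j; rewrite /e0 /=; case: (t j) => [[]|].
have [g gE] := e0r e; rewrite !gE; move/equivP: ee' => ee'.
apply/equivP => Q psi d dM.
have E1 (a : P -> U) : glue (glue a sval \o g) d = glue a (glue sval d)
    \o glue (glue inl (inr \o inl) \o g) (inr \o inr) :> ('I_k.+1 + Q -> U).
  by apply: funext => -[j|//] /=; case: (g j).
rewrite !E1 -!sat_rename; apply: ee' => -[c|v] /=; [exact: svalP|exact: dM].
Qed.

Lemma generic_gtype (I : Type) (p : set (pformula I)) :
  Small I -> global_type p -> invariant M p -> generic (gtype p).
Proof.
move=> sI [pc pN] pI; split=> [E ME sE|s E E' a sA sM sE pa phi [pphi [psi _ psiE]]|].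
- have [||phi []|n phi phip|a ap] // :=
    @monster_saturated _ _ _ _ hU I E (p `&` forms_over E).
    by apply: pc => k; case: (phip k).
  by exists a.
- have eE' (c : {c | E' c}) : E' (sval c) := svalP c.
  have [d dP] := choice (fun c : {c | E' c} => let: ex_intro2 d h1 h2 := sE _ (eE' c)
    in ex_intro (fun d => E d /\ s d = sval c) d (conj h1 h2)).
  have ed : sval = s \o d by apply: funext => c; rewrite /= (dP c).2.
  have pd : p (subst psi d).
    apply: (@invariant_subst _ _ _ _ sval) => //; last by rewrite psiE.
    rewrite ed; apply/equivP => Q chi e eM; symmetry.
    by move/equivP: (aut_equiv d sA sM) => /(_ _ chi e eM).
  have : psat a (subst psi d).
    apply: pa; split=> //; pose d' c : {c | E c} := exist _ (d c) (dP c).1.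
    exists (rename (glue inl (inr \o d')) psi) => //.
    by rewrite /subst rename_rename; congr rename; apply: funext => -[].
  rewrite -psiE !psat_subst -(sat_aut _ _ sA).
  suff -> : s \o glue a d = glue (s \o a) sval by [].
  by rewrite ed; apply: funext => -[].
- move=> E a a' ME sE pa pa'; apply: equiv_aut => //; apply/equivP => P phi e eE.
  have [phi' fphi' phiE] := subst_over phi eE; rewrite -!phiE.
  have [pphi|pphi] := pN (subst phi' sval).
    by split=> _; [apply: pa'|apply: pa].
  have fN : forms_over E (Not (subst phi' sval)) by exists (Not phi').
  by split=> h; [case: (pa _ (conj pphi fN))|case: (pa' _ (conj pphi fN))].
Qed.

(** * Trees of coheirs *)

Section Utower.
Context {n m : nat} (psi : formula L ('I_n + 'I_m)).
Context (Gq : set U -> ('I_m -> U) -> Prop) (gGq : generic Gq).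

(** Coheirs of trees of height [h] with nodes of type [F], grown from the leaves: a
    root realizing [Gq] over everything below is put above two copies of a smaller
    tree, the right one generic over the left one.  Thus antichains are generated by
    [F] and branches, read upwards, by [Gq]. *)
Fixpoint utower (F : set_system (Mt 'I_m)) (h : nat)
    (S : set_system (Mt (seq bool * 'I_m))) : Prop :=
  UltraFilter S /\
  if h is h.+1 then exists S', [/\ utower F h S',
      forall E B, M `<=` E -> real S E B ->
        [/\ real S' E (cone [:: false] B),
          real S' (E `|` range (cone [:: false] B)) (cone [:: true] B) &
          real F E (node B [::])] &
      forall B, real S M B ->
        Gq (M `|` (range (cone [:: false] B) `|` range (cone [:: true] B)))
           (node B [::])]
  else True.

Definition unsat (k : nat) (G : set U -> ('I_m -> U) -> Prop) : Prop :=
  forall l, gens M (nseq k G) l -> ~ satisfiable psi l.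

Lemma utower_ultra F h S : utower F h S -> UltraFilter S.
Proof. by case: h => [|h] []. Qed.

Lemma utower_cone F h nu S B : utower F (h + size nu) S -> real S M B ->
  exists2 S', utower F h S' & real S' M (cone nu B).
Proof.
elim: nu S B => [|b nu IH] S B; first by rewrite addn0 cone_nil; exists S.
rewrite addnS => -[_ [S' [tS' hS' _]]] SB.
have [S0 S1 _] := hS' M B (@subset_refl _ M) SB.
have : real S' M (cone [:: b] B).
  case: b => //.
  apply: (generic_mono (generic_real (small_tree m) (utower_ultra tS')) _ S1).
  by left.
by move=> /(IH _ _ tS')[S2 tS2 SB2]; exists S2.
Qed.

Lemma Alls_take (A : Type) (P : A -> Prop) k (l : seq A) :
  Alls P l -> Alls P (take k l).
Proof. by elim: l k => [|a l IH] [|k] //= [Pa /IH]. Qed.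

Lemma Alls_rev (A : Type) (P : A -> Prop) (l : seq A) : Alls P (rev l) <-> Alls P l.
Proof. by elim: l => [|a l IH] //; rewrite rev_cons -cats1 Alls_cat IH /=; tauto. Qed.

Lemma utower_branch F h S B (l : seq (seq bool)) :
  utower F h S -> real S M B -> pairwise sprefix l ->
  (forall eta, eta \in l -> size eta < h)%N ->
  gens M (nseq (size l) Gq) (rev [seq node B eta | eta <- l]).
Proof.
move=> tS SB; elim: l => [|eta l IH] //= /andP[/allP etal lp] lh.
have {}IH : gens M (nseq (size l) Gq) (rev [seq node B eta0 | eta0 <- l]).
  by apply: IH => // nu nul; apply: lh; rewrite inE nul orbT.
have nE : nseq (size l).+1 Gq = nseq (size l) Gq ++ [:: Gq].
  by rewrite -addn1 nseqD.
change (gens M (nseq (size l).+1 Gq) (rev [seq node B eta0 | eta0 <- eta :: l])).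
rewrite nE map_cons rev_cons -cats1.
have etah : (size eta < h)%N by apply: lh; rewrite inE eqxx.
have hE : (h = (h - size eta).-1.+1 + size eta)%N.
  by rewrite prednK ?subn_gt0 // subnK // ltnW.
rewrite hE in tS; have [S1 [_ [S2 [_ _ Gq1]]] SB1] := utower_cone tS SB.
apply: (gens_cat (F := M `|` (range (cone [:: false] (cone eta B)) `|`
  range (cone [:: true] (cone eta B))))) => //.
- apply/Alls_rev/Alls_map/AllsP => nu nul _ /= [y _ <-].
  have /sprefixP[b [w ->]] := etal _ nul.
  right; case: b; [right|left]; by exists (w, y); rewrite // /node /cone /= -catA.
- split=> //; have := Gq1 _ SB1; rewrite /node /cone /= cats0.
  exact.
Qed.

Lemma gens_take (I : Type) E (Gs : seq (set U -> (I -> U) -> Prop)) l k :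
  gens E Gs l -> gens E (take k Gs) (take k l).
Proof. by elim: Gs l E k => [|G Gs IH] [|a l] E [|k] //= [Ga /IH]. Qed.

Lemma unsat_some k G l : generic G ->
  gens M (nseq k G) l -> ~ satisfiable psi l -> unsat k G.
Proof.
move=> gG gl nl l' gl' [x xl']; apply: nl.
have gGs : Alls (@generic _) (nseq k G) by elim: (k) => //= k' IH; split.
have [s [sA _ <-]] := gens_uniq (small_countable K_nat _) gGs
  (@subset_refl _ M) M_small gl' gl.
exists (s \o x); apply/Alls_map; apply: Alls_impl xl' => a.
rewrite -(sat_aut _ (glue x a) sA).
suff -> : s \o glue x a = glue (s \o x) (s \o a) by [].
by apply: funext => -[].
Qed.

Lemma no_utowers (k : nat) (F : set_system (Mt 'I_m)) :
  NATP U -> UltraFilter F -> unsat k Gq -> (forall j, ~ unsat j (real F)) ->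
  ~ forall h, exists S, utower F h S.
Proof.
move=> natp uF nq nF tF; apply: (no_towers (psi := psi) (c := k) natp) => D s.
have [S tS] := tF D.
have [Ss [SsD Sstow Ssrel]] : exists Ss : nat -> set_system (Mt (seq bool * 'I_m)),
    [/\ Ss D = S, forall h, UltraFilter (Ss h) /\ (h <= D -> utower F h (Ss h))%N &
      forall h E B, (h < D)%N -> M `<=` E -> real (Ss h.+1) E B ->
        [/\ real (Ss h) E (cone [:: false] B),
          real (Ss h) (E `|` range (cone [:: false] B)) (cone [:: true] B) &
          real F E (node B [::])]].
  elim: D S tS => [|D IH] S tS.
    by exists (fun=> S); split=> // h; split=> [|]; [exact: utower_ultra tS|case: h].
  have [uS [S' [tS' hS' _]]] := tS; have [Ss [SsD Sstow Ssrel]] := IH _ tS'.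
  exists (fun h => if (h <= D)%N then Ss h else S); split.
  - by rewrite ltnn.
  - move=> h; split; first by case: ifP => // _; apply: (Sstow h).1.
    rewrite leq_eqVlt ltnS => /orP[/eqP->|hD]; first by rewrite ltnn.
    by rewrite hD; apply: (Sstow h).2.
  - move=> h E B; rewrite ltnS => hD ME; rewrite hD.
    have [->|hneD] := eqVneq h D; first by rewrite ltnn SsD; apply: hS'.
    have hltD : (h < D)%N by rewrite ltn_neqAle hneD.
    by rewrite hltD; apply: Ssrel.
pose G h := real (Ss h).
have gG h : generic (G h) := generic_real (small_tree m) (Sstow h).1.
exists G; split.
- by split=> // h E B hD ME /(Ssrel _ _ _ hD ME)[].
- move=> ns l _ nsD gl.
  have aux E : M `<=` E -> gens E [seq at_node [::] (G g) | g <- ns] l ->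
      gens E (nseq (size ns) (real F)) l.
    elim: ns l E nsD {gl} => [|h ns IH] [|a l] //= E nsD ME [[B GB ->] gl]; split.
      have := nsD h; rewrite inE eqxx => /(_ isT) /andP[h0 hD].
      by rewrite -(prednK h0) in GB; have [|] // := Ssrel _ E B _ ME GB;
         rewrite prednK.
    apply: IH gl => [h' h'ns|c /ME]; last by left.
    by apply: nsD; rewrite inE h'ns orbT.
  have {aux}gl := aux M (@subset_refl _ M) gl.
  apply: contrapT => nl; apply: (nF (size ns)).
  by apply: unsat_some gl nl; exact: generic_real (small_countable K_nat _) uF.
- move=> h B l hD GB kl lp lh [x xl].
  have := utower_branch ((Sstow h).2 hD) GB lp lh.
  move=> /(gens_take k); rewrite take_nseq // => /nq; apply; exists x.
  by apply/Alls_take/Alls_rev.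
Qed.

End Utower.

(** * Kim-dividing is witnessed by coheirs *)

(** Boxes with arbitrary sides generate a proper filter, by the axiom of choice. *)
Lemma ultra_box (P V : Type) (F : P -> set_system (Mt V)) :
  (forall p, UltraFilter (F p)) ->
  exists2 R : set_system (Mt (P * V)), UltraFilter R &
    forall p, fmap (fun m : Mt (P * V) => (fun v => m (p, v)) : Mt V) R = F p.
Proof.
move=> uF; pose box (Z : P -> set (Mt V)) : set (Mt (P * V)) :=
  [set m | forall p, Z p (fun v => m (p, v))].
pose B : set_system (Mt (P * V)) :=
  [set X | exists2 Z, forall p, F p (Z p) & X = box Z].
have [||X Y [Z FZ ->] [Z' FZ' ->]|R uR BR] := @ultra_base _ B.
- by eexists; exists (fun=> setT) => // p; apply: filterT.
- move=> X [Z FZ ->].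
  have [m mP] := choice (fun p =>
    @filter_ex _ _ (ultra_proper (UltraFilter := uF p)) _ (FZ p)).
  by exists (fun pv => m pv.1 pv.2) => p; apply: mP.
- exists (box (fun p => Z p `&` Z' p)).
    by exists (fun p => Z p `&` Z' p) => // p; apply: filterI.
  by move=> m h; split=> p; case: (h p).
exists R => // p; apply: ultra_eq => //; first exact: ultra_fmap.
move=> X FX; have : R (box (fun q => [set v | q = p -> X v])).
  apply: BR; eexists => // q; have [->|qp] := pselect (q = p).
    by apply: (filterS _ FX) => v Xv _.
  suff -> : [set v | q = p -> X v] = setT by apply: filterT.
  by apply/seteqP; split=> // v _ /qp.
move=> Rbox; change (R [set m : Mt (P * V) | X (fun v => m (p, v))]).
by apply: (filterS _ Rbox) => m /(_ p erefl).
Qed.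

Section CoheirWitness.
Context {n m : nat} (psi : formula L ('I_n + 'I_m)).
Context (Gq : set U -> ('I_m -> U) -> Prop) (gGq : generic Gq).

(** The coheir of a new root cannot be prescribed; it is only found by extending the
    coheir of the tree below.  If for every type of nodes the heights of the trees
    were bounded, choose a tree of maximal height for each type, take two
    independent copies of each, amalgamate all of them, and add a root realizing
    [Gq] over everything.  For the type of this root, the tree of maximal height
    has been exceeded. *)
Lemma utower_all_heights :
  exists F : set_system (Mt 'I_m), UltraFilter F /\
    forall h, exists S, utower Gq F h S.
Proof.
apply: contrapT => nF; pose V := (seq bool * 'I_m)%type.
have [m0 _] := inhabited_Mt V.
have maxF (F : set_system (Mt 'I_m)) : exists hS : nat * set_system (Mt V),
    UltraFilter hS.2 /\ (UltraFilter F -> utower Gq F hS.1 hS.2 /\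
      ~ exists S', utower Gq F hS.1.+1 S').
  have u0 : UltraFilter (principal_filter m0) by apply: principal_filter_ultra.
  have [uF|] := pselect (UltraFilter F); last by exists (0, principal_filter m0).
  have /existsNP[h0 h0P] : ~ forall h, exists S, utower Gq F h S.
    by move=> h; apply: nF; exists F.
  elim: h0 h0P => [|h IH] hP; first by case: hP; exists (principal_filter m0).
  have [[S tS]|/IH//] := pselect (exists S, utower Gq F h S).
  by exists (h, S); split=> [|_]; first exact: utower_ultra tS.
have {maxF}[hS hSP] := choice maxF.
pose S F := (hS F).2; have uS F : UltraFilter (S F) := (hSP F).1.
have [R uR RS] := ultra_box (fun F => ultra_prodF (uS F) (uS F)).
pose P := set_system (Mt 'I_m).
have sV : Small V by apply: small_countable.
have sP : Small P.
  apply: small_set => //; apply: small_set => //; apply: small_arrow => //.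
    exact: small_countable.
  exact: small_sig.
have sPV : Small (P * (V + V)) by apply: small_prod => //; apply: small_sum.
have [A RA] := generic_ex (generic_real sPV uR) (@subset_refl _ M) M_small.
have [||d Gd] := generic_ex gGq (E := M `|` range A).
- by move=> c; left.
- by apply: small_setUrange.
have [R' [uR' R'R R'Ad]] := coheir_extend d uR RA.
pose root : 'I_m -> (P * (V + V)) + 'I_m := inr.
pose F : set_system (Mt 'I_m) :=
  fmap (fun t : Mt ((P * (V + V)) + 'I_m) => t \o root : Mt 'I_m) R'.
have uF : UltraFilter F by apply: ultra_fmap.
have [tS []] := (hSP F).2 uF.
pose tree (v : V) : ((P * (V + V)) + 'I_m) + {c | M c} := inl
  match v.1 with
  | [::] => inr v.2
  | false :: eta => inl (F, inl (eta, v.2))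
  | true :: eta => inl (F, inr (eta, v.2))
  end.
have uS' : UltraFilter (fmap (Mt_map tree) R') by apply: ultra_fmap.
exists (fmap (Mt_map tree) R'); split=> //; exists (S F); split=> //.
- move=> E B ME S'B.
  pose cones (v : V + V) : V + {c | M c} := match v with
    | inl v => inl (false :: v.1, v.2) | inr v => inl (true :: v.1, v.2) end.
  pose top (y : 'I_m) : V + {c | M c} := inl ([::], y).
  have rootB : real F E (node B [::]) := real_map top ME S'B.
  have := real_map cones ME S'B.
  have -> : fmap (Mt_map cones) (fmap (Mt_map tree) R') = prodF (S F) (S F).
    rewrite -(RS F) -R'R; apply/funext => X; congr (R' _); apply/funext => t /=.
    by congr X; apply: funext => -[[eta y]|[eta y]].
  have -> : glue B sval \o cones = glue (cone [:: false] B) (cone [:: true] B).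
    by apply: funext => -[].
  by move=> /prodF_real[] // S0 S1.
- move=> B S'B.
  have S'Ad := real_map tree (@subset_refl _ M) R'Ad.
  have [s [sA sM sB]] := generic_uniq (generic_real sV uS') (@subset_refl _ M) M_small
    S'Ad S'B.
  have -> : node B [::] = s \o d by rewrite -sB.
  apply: (generic_aut gGq sA sM _ Gd) => c [Mc|].
    by exists c; [left|apply: sM].
  rewrite -sB => -[] [[eta y] _ <-]; rewrite /cone /=.
    by exists (A (F, inl (eta, y))) => //; right; eexists.
  by exists (A (F, inr (eta, y))) => //; right; eexists.
Qed.

(** The type [F] of the nodes of the trees must be unsatisfiable along its Morley
    sequences, as otherwise these trees contradict NATP. *)
Lemma coheir_witness k : NATP U -> unsat psi k Gq ->
  exists F : set_system (Mt 'I_m), [/\ UltraFilter F,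
    exists2 a, Gq M a & real F M a & exists j, unsat psi j (real F)].
Proof.
move=> natp nq; have [F [uF tF]] := utower_all_heights; exists F; split=> //.
  have [S tS] := tF 1; have [_ [S' [_ h1 h2]]] := tS.
  have [B SB] := generic_ex (generic_real (small_tree m) (utower_ultra tS))
    (@subset_refl _ M) M_small.
  exists (node B [::]); last by case: (h1 M B (@subset_refl _ M) SB).
  by apply: (generic_mono gGq _ (h2 B SB)) => c; left.
apply: contrapT => nF; apply: (no_utowers gGq natp uF nq _ tF) => j nj.
by apply: nF; exists j.
Qed.

End CoheirWitness.

(** The type of the subtuple named by [f] in realizations of [G], some of whose
    entries may be named elements of [M]. *)
Definition pushG (I I' : Type) (f : I' -> I + {c | M c})
    (G : set U -> (I -> U) -> Prop) : set U -> (I' -> U) -> Prop :=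
  fun E a' => exists2 a, G E a & a' = glue a sval \o f.

Definition unsat_along (n : nat) (J : Type) (phi : Mformula M 'I_n J) (k : nat)
    (G : set U -> (J -> U) -> Prop) : Prop :=
  forall l, gens M (nseq k G) l ->
    ~ exists x : 'I_n -> U, Alls (fun a => psat x (inst phi a)) l.

Lemma gens_impl (I : Type) E (G G' : set U -> (I -> U) -> Prop) k l :
  (forall E a, M `<=` E -> G E a -> G' E a) -> M `<=` E ->
  gens E (nseq k G) l -> gens E (nseq k G') l.
Proof.
move=> GG'; elim: k l E => [|k IH] [|a l] //= E ME [Ga gl]; split; first exact: GG'.
by apply: IH gl => c /ME; left.
Qed.

Lemma all_nseq (I : Type) (G : set U -> (I -> U) -> Prop) k :
  generic G -> Alls (@generic I) (nseq k G).
Proof. by move=> gG; elim: k => //= k IH; split. Qed.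

Lemma gens_push (I I' : Type) (f : I' -> I + {c | M c}) G k E l :
  Small I -> generic G -> M `<=` E -> gens E (nseq k G) l ->
  gens E (nseq k (pushG f G)) [seq glue a sval \o f | a <- l].
Proof.
move=> sI gG; elim: k l E => [|k IH] [|a l] //= E ME [Ga gl]; split; first by exists a.
apply: (gens_mono (E := E `|` range a)).
- exact: all_nseq (generic_reindex f sI gG).
- move=> c [Ec|[i _ <-]]; first by left.
  rewrite /=; case: (f i) => [j|d] /=; first by right; exists j.
  by left; apply/ME/svalP.
- by apply: IH gl => c /ME; left.
Qed.

Lemma finite_formula (n : nat) (J : Type) (phi : Mformula M 'I_n J) :
  exists m (f : 'I_m -> J + {c | M c}) (psi : formula L ('I_n + 'I_m)),
    forall (x : 'I_n -> U) (a : J -> U),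
      psat x (inst phi a) <-> sat psi (glue x (glue a sval \o f)).
Proof.
have [c0] := elementary_inhabited M_elem.
have [k [r [t supp]]] := finite_support phi.
exists k.+1, (fun j => if t j is Some (inr v) then v else inr c0).
exists (rename (glue inl (inr \o r \o inr)) phi) => x a.
rewrite psat_subst sat_rename; apply: supp => -[//|v] /= tr.
by rewrite tr.
Qed.

Section Reduce.
Context {n m : nat} {J : Type} (sJ : Small J) (phi : Mformula M 'I_n J).
Context (f : 'I_m -> J + {c | M c}) (psi : formula L ('I_n + 'I_m)).
Context (phiE : forall (x : 'I_n -> U) (a : J -> U),
  psat x (inst phi a) <-> sat psi (glue x (glue a sval \o f))).

Lemma unsat_alongE G k : generic G -> unsat psi k (pushG f G) <-> unsat_along phi k G.
Proof.
move=> gG.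
have satE l (x : 'I_n -> U) : Alls (fun a => psat x (inst phi a)) l <->
    Alls (fun a => sat psi (glue x a)) [seq glue a sval \o f | a <- l].
  by rewrite Alls_map; split; apply: Alls_impl => a /phiE.
split=> [un l gl [x /satE xl]|un].
  by apply: (un _ (gens_push f sJ gG (@subset_refl _ M) gl)); exists x.
have [l gl] := gens_ex sJ (all_nseq k gG) (@subset_refl _ M) M_small.
apply: (unsat_some (generic_reindex f sJ gG) (gens_push f sJ gG (@subset_refl _ M) gl)).
by move=> [x /satE xl]; apply: (un _ gl); exists x.
Qed.

End Reduce.

Lemma unsat_along_some (n : nat) (J : Type) (phi : Mformula M 'I_n J) k G l :
  Small J -> generic G -> gens M (nseq k G) l ->
  ~ (exists x : 'I_n -> U, Alls (fun a => psat x (inst phi a)) l) ->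
  unsat_along phi k G.
Proof.
move=> sJ gG gl nl; have [m [f [psi phiE]]] := finite_formula phi.
apply/(unsat_alongE sJ phiE k gG).
apply: (unsat_some (generic_reindex f sJ gG) (gens_push f sJ gG (@subset_refl _ M) gl)).
move=> [x /Alls_map xl]; apply: nl; exists x.
by apply: Alls_impl xl => a /phiE.
Qed.

Lemma gtype_mono (I : Type) (p : set (pformula I)) E E' a :
  E' `<=` E -> gtype p E a -> gtype p E' a.
Proof.
move=> EE' pa phi [pphi fphi]; apply: pa; split=> //.
exact: forms_over_mono EE' fphi.
Qed.

Lemma gtype_tp (I : Type) (p : set (pformula I)) (b : I -> U) :
  global_type p -> tp b M `<=` p -> gtype p M b.
Proof.
move=> [pc _] bp phi [pphi [psi _ psiE]]; apply: contrapT => nphi.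
have nphip : p (Not phi).
  by apply: bp; split=> //; exists (Not psi); rewrite // -psiE.
have [a _ aP] := pc 2 (fun j : 'I_2 => if j == ord0 then phi else Not phi)
  (fun j => if j == ord0 as c return p (if c then phi else Not phi)
            then pphi else nphip).
by apply: (aP ord_max); apply: (aP ord0).
Qed.

(** An inconsistent sequence has an inconsistent initial segment, whose length serves
    for all sequences generated by [G], as these are conjugate. *)
Lemma generated_unsat (n : nat) (J : Type) (phi : Mformula M 'I_n J) G s :
  Small J -> generic G -> (forall E E' a, E' `<=` E -> G E a -> G E' a) ->
  (forall i, G (M `|` \bigcup_(j in [set j | (j < i)%N]) range (s j)) (s i)) ->
  ~ consistent [set inst phi (s i) | i in [set: nat]] <->
  exists k, unsat_along phi k G.
Proof.
move=> sJ gG Gmono sG.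
have gl k : gens M (nseq k G) [seq s i | i <- iota 0 k].
  by apply: (generated_generic (f := id)) => // i j /andP[].
split=> [/consistentP/existsNP[l nl]|[k un] /consistentP h]; last first.
  by have [x xl] := h (iota 0 k); apply: (un _ (gl k)); exists x; apply/Alls_map.
exists (\max_(i <- l) i).+1; apply: unsat_along_some (gl _) _ => // -[x].
move=> /Alls_map/AllsP xl; apply: nl; exists x; apply/AllsP => i il; apply: xl.
by rewrite mem_iota add0n ltnS /=; apply: leq_bigmax_seq.
Qed.

Lemma morley_sequence (I : Type) (F : set_system (Mt I)) (b : I -> U) :
  Small I -> UltraFilter F -> real F M b ->
  exists2 s : nat -> I -> U, s 0 = b &
    forall i, real F (M `|` \bigcup_(j in [set j | (j < i)%N]) range (s j)) (s i).
Proof.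
move=> sI uF Fb; pose Eof (l : seq (I -> U)) := foldr (fun a E => E `|` range a) M l.
have ME l : M `<=` Eof l by elim: l => //= a l IH c /IH; left.
have sE l : small K (Eof l).
  by elim: l => [|a l IH] /=; [exact: M_small|exact: small_setUrange].
have [next nextP] := choice (fun l => generic_ex (generic_real sI uF) (ME l) (sE l)).
pose fix sq k : seq (I -> U) :=
  if k is k'.+1 then (if k' is 0 then b else next (sq k')) :: sq k' else [::].
pose s k := if k is 0 then b else next (sq k).
have sqE k : sq k.+1 = s k :: sq k by case: k.
exists s => // i; apply: (generic_mono (generic_real sI uF) (E := Eof (sq i))).
  move=> c [Mc|[j /= ji [y _ <-]]]; first exact: ME.
  elim: i ji => // i IH; rewrite ltnS leq_eqVlt sqE /= => /orP[/eqP->|/IH ?].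
    by right; exists y.
  by left.
case: i => [|i]; last exact: nextP.
exact: Fb.
Qed.

Lemma kim_divides_along (n : nat) (J : Type) (phi : Mformula M 'I_n J) (b : J -> U)
    (F : set_system (Mt J)) k :
  Small J -> UltraFilter F -> real F M b -> unsat_along phi k (real F) ->
  kim_divides phi b.
Proof.
move=> sJ uF Fb un; have [s s0 sF] := morley_sequence sJ uF Fb.
exists s.
  exists (typ F); split; first exact: global_typ.
  - exact: tp_typ.
  - exact: invariant_typ.
  - by move=> i; apply/(gtype_typ _ _ uF)/sF.
apply/(generated_unsat phi sJ (generic_real sJ uF) _ sF); last by exists k.
by move=> E E' a; apply: generic_mono; apply: generic_real.
Qed.

(** The witness is found for the finitely many parameters that occur in [phi], and
    then extended to the whole tuple. *)
Lemma kim_divides_coheir (n : nat) (J : Type) (phi : Mformula M 'I_n J) (b : J -> U) :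
  NATP U -> Small J -> kim_divides phi b ->
  exists F : set_system (Mt J), [/\ UltraFilter F, real F M b &
    exists k, unsat_along phi k (real F)].
Proof.
move=> natp sJ [s [p [pg bp pI ps]] ns].
have gp := generic_gtype sJ pg pI.
have [k un] := (generated_unsat phi sJ gp (@gtype_mono _ p) ps).1 ns.
have [m [f [psi phiE]]] := finite_formula phi.
have gq := generic_reindex f sJ gp.
have [F0 [uF0 [a qa F0a] [j unj]]] :=
  coheir_witness gq natp ((unsat_alongE sJ phiE k gp).2 un).
have qb : pushG f (gtype p) M (glue b sval \o f) by exists b => //; exact: gtype_tp.
have [s1 [s1A s1M s1a]] := generic_uniq gq (@subset_refl _ M) M_small qa qb.
have F0b : real F0 M (glue b sval \o f).
  rewrite -s1a.
  apply: (generic_aut (generic_real (small_countable K_nat _) uF0)) F0a => //.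
  by move=> c Mc; exists c => //; apply: s1M.
have [F [uF FF0 Fb]] := coheir_lift uF0 F0b.
exists F; split=> //; exists j; apply/(unsat_alongE sJ phiE j (generic_real sJ uF)).
move=> l gl; apply: unj; apply: gens_impl gl => // E _ ME [a' Fa' ->].
by rewrite -FF0; apply: real_map.
Qed.

(** * A small set over which coheirs are determined *)

Definition M_complete (N : set U) : Prop :=
  forall n (c : 'I_n -> U), exists2 c' : 'I_n -> U,
    (forall k, N (c' k)) & equiv M c c'.

(** Coheirs are [M]-invariant, so membership of a formula with parameters [e] can
    be read off at a copy of [e] in [N]. *)
Lemma real_determined (N : set U) (I : Type) (F F' : set_system (Mt I)) a E A :
  M_complete N -> real F N a -> real F' N a -> real F E A -> real F' E A.
Proof.
move=> NM Fa F'a FA P phi e eE; rewrite (FA _ _ _ eE).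
have [u0] := carrier_inhabited U.
have [k [r [t supp]]] := finite_support phi.
pose q : I + P -> I + 'I_k.+1 := glue inl (inr \o r \o inr).
pose e0 j : U := oapp (glue (fun=> u0) e) u0 (t j).
have [c' c'N /equivP ec'] := NM _ e0.
have phiE (m : Mt I) : sat phi (glue (sval \o m) e) <->
    sat (rename q phi) (glue (sval \o m) c').
  have -> : sat phi (glue (sval \o m) e) <-> sat (rename q phi) (glue (sval \o m) e0).
    rewrite sat_rename; apply: supp => -[//|v] /= tr.
    by rewrite /e0 /= tr.
  pose w : I + 'I_k.+1 -> 'I_k.+1 + I := glue inr inl.
  have wE (d : 'I_k.+1 -> U) (z : I -> U) : glue d z \o w = glue z d.
    by apply: funext => -[].
  rewrite -!wE -!(sat_rename w); apply: ec' => i; exact: svalP.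
have -> : [set m : Mt I | sat phi (glue (sval \o m) e)]
    = [set m : Mt I | sat (rename q phi) (glue (sval \o m) c')].
  by apply/seteqP; split=> m /phiE.
by rewrite -(Fa _ _ _ c'N) -(F'a _ _ _ c'N).
Qed.

(** The type over [M] of a finite tuple is determined by the sets of tuples of [M]
    that its formulas define, so there are few such types. *)
Lemma M_complete_ex : exists N, [/\ small K N, M `<=` N & M_complete N].
Proof.
have [c0] := elementary_inhabited M_elem; have [u0] := carrier_inhabited U.
pose pts n (phi : formula L ('I_n + {c | M c})) : set (nat -> {c | M c}) :=
  [set m | sat phi (glue (fun k : 'I_n => sval (m k)) sval)].
pose fam n (c : 'I_n -> U) : set (set (nat -> {c | M c})) :=
  [set X | exists2 phi, sat phi (glue c sval) & X = pts n phi].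
have famE n (c c' : 'I_n -> U) : fam n c = fam n c' -> equiv M c c'.
  move=> cc'; have h (phi : formula L ('I_n + {c | M c})) :
      sat phi (glue c sval) -> sat phi (glue c' sval).
    move=> sphi; have : fam n c (pts n phi) by exists phi.
    rewrite cc' => -[phi' sphi' phiE]; apply: contrapT => nphi.
    pose chi := Ands [:: phi'; Not phi].
    pose w : 'I_n + {c | M c} -> {c | M c} + 'I_n := glue inr inl.
    have wE (d : 'I_n -> U) (z : {c | M c} -> U) : glue z d \o w = glue d z.
      by apply: funext => -[].
    have : sat (rename w chi) (glue (sval \o id) c').
      by rewrite sat_rename wE; apply/sat_and.
    move=> /(elementary_exists M_elem)[m]; rewrite sat_rename wE => /sat_and[s1 s2].
    pose m' (k : nat) : {c | M c} := oapp m c0 (insub k).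
    have m'E : (fun k : 'I_n => sval (m' k)) = sval \o m.
      by apply: funext => k; rewrite /m' valK.
    suff : pts n phi m' by rewrite /pts /= m'E => /s2.
    by rewrite phiE /pts /= m'E.
  apply/equivP => P phi e eM; have [phi' _ phiE] := subst_over phi eM.
  rewrite -!phiE !psat_subst; split; first exact: h.
  by move=> sc'; apply: contrapT => nsc; apply: (h (Not phi') nsc sc').
have [rep repP] : exists rep : nat * set (set (nat -> {c | M c})) -> nat -> U,
    forall n (c : 'I_n -> U), fam n (fun k => rep (n, fam n c) k) = fam n c.
  have h (p : nat * set (set (nat -> {c | M c}))) : exists d : nat -> U,
      forall c : 'I_p.1 -> U, fam p.1 c = p.2 -> fam p.1 (fun k => d k) = p.2.
    have [[c cE]|nc] := pselect (exists c : 'I_p.1 -> U, fam p.1 c = p.2).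
      exists (fun k => oapp c u0 (insub k)) => _ _.
      suff -> : (fun k : 'I_p.1 => oapp c u0 (insub (val k))) = c by [].
      by apply: funext => k; rewrite valK.
    by exists (fun=> u0) => c cE; case: nc; exists c.
  have [rep repP] := choice h.
  by exists rep => n c; apply: (repP (n, fam n c) c).
pose g (v : (nat * set (set (nat -> {c | M c}))) * nat) := rep v.1 v.2.
exists (M `|` range g); split.
- apply: small_setU => //; apply: small_range; apply: small_prod => //.
  apply: small_prod => //; apply: small_set => //; apply: small_set => //.
  by apply: small_arrow => //; apply: small_sig.
- by move=> c; left.
- move=> n c; exists (fun k => rep (n, fam n c) k).
    by move=> k; right; exists (n, fam n c, val k).
  by apply: famE; rewrite repP.
Qed.

(** The sets from which trees will be kept independent.  A tree independent from
    [N k.+1] has a copy inside [N k.+1], which allows to duplicate it.  Trees of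
    [m]-tuples are covered for all [m], so that one chain serves all formulas. *)
Definition saturating_chain (N : nat -> set U) : Prop :=
  [/\ forall k, small K (N k), M `<=` N 0, forall k, N k `<=` N k.+1,
    M_complete (N 0) &
    forall k m (S : set_system (Mt (seq bool * 'I_m))), UltraFilter S ->
      exists2 A, real S (N k) A & range A `<=` N k.+1].

Lemma saturating_chain_ex :
  exists2 N, saturating_chain N & small K (\bigcup_k N k).
Proof.
have [N0 [sN0 MN0 cN0]] := M_complete_ex.
have [c0] := elementary_inhabited M_elem; have [u0] := carrier_inhabited U.
(* codes trees of tuples of all lengths *)
pose V := (seq bool * nat)%type.
have sV : Small V by apply: small_countable.
have ex (NS : set U * set_system (Mt V)) : exists A : V -> U,
    small K NS.1 -> M `<=` NS.1 -> UltraFilter NS.2 -> real NS.2 NS.1 A.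
  have [[s1 [s2 s3]]|h] := pselect (small K NS.1 /\ M `<=` NS.1 /\ UltraFilter NS.2).
    by have [A] := generic_ex (generic_real sV s3) s2 s1; exists A.
  by exists (fun=> u0) => h1 h2 h3; case: h.
have [re reP] := choice ex.
pose step (N : set U) := N `|` range (fun p : set_system (Mt V) * V => re (N, p.1) p.2).
have sSV : Small (set_system (Mt V) * V).
  apply: small_prod => //; apply: small_set => //; apply: small_set => //.
  by apply: small_arrow => //; apply: small_sig.
pose N k := iter k step N0.
have sN k : small K (N k).
  by elim: k => //= k IH; apply: small_setU => //; apply: small_range.
have NS k : N k `<=` N k.+1 by move=> c; left.
have MN k : M `<=` N k by elim: k => // k IH c /IH; left.
exists N; last first.
  pose g (v : nat * (set_system (Mt V) * V)) := re (N v.1, v.2.1) v.2.2.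
  apply: (@small_sub _ _ _ (N0 `|` range g)).
    move=> c [k _]; elim: k => [|k IH] /=; first by left.
    by move=> [/IH//|[p _ <-]]; right; exists (k, p).
  by apply: small_setU => //; apply: small_range; apply: small_prod.
split=> // k m S uS.
pose f (v : V) : seq bool * 'I_m + {c | M c} :=
  if insub v.2 is Some y then inl (v.1, y) else inr c0.
pose g (v : seq bool * 'I_m) : V + {c | M c} := inl (v.1, val v.2).
have uS' : UltraFilter (fmap (Mt_map f) S) by apply: ultra_fmap.
have := real_map g (MN k) (reP (N k, fmap (Mt_map f) S) (sN k) (MN k) uS').
have -> : fmap (Mt_map g) (fmap (Mt_map f) S) = S.
  apply/funext => X; congr S; apply/funext => t /=; congr X.
  by apply: funext => -[eta y]; rewrite /Mt_map /= /f /= valK.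
move=> SA; eexists; first exact: SA.
by move=> _ [v _ <-] /=; right; exists (fmap (Mt_map f) S, (v.1, val v.2)).
Qed.

(** * Coheirs given by the independence relation *)

Section Independence.
Context {ind : ternary_relation U}.
Context (ind_inv : pre_independence K ind) (ind_heir : stronger_than_heir K M ind)
  (ind_monotone : monotonicity K M ind) (ind_full : full_existence K M ind)
  (ind_chain : right_chain_condition K M ind)
  (ind_srt : strong_right_transitivity K M ind).

Lemma ind_sub A A' B B' : small K A' -> small K B' -> A `<=` A' -> B `<=` B' ->
  ind A' M B' -> ind A M B.
Proof.
move=> sA sB AA BB; rewrite -((setUidPr _ _).2 AA) -((setUidPr _ _).2 BB).
by apply: ind_monotone => //; [exact: small_sub AA sA|exact: small_sub BB sB].
Qed.

Lemma image_fixes (s : U -> U) (E : set U) : fixes s E -> s @` E = E.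
Proof.
move=> sE; apply/seteqP; split=> [_ [c Ec <-]|c Ec]; first by rewrite sE.
by exists c => //; apply: sE.
Qed.

Lemma image_range (s : U -> U) (I : Type) (A : I -> U) :
  s @` range A = range (s \o A).
Proof.
apply/seteqP; split=> [_ [_ [i _ <-] <-]|_ [i _ <-]]; first by exists i.
by exists (A i) => //; exists i.
Qed.

Lemma ind_aut s A B : automorphism s -> fixes s M -> small K A -> small K B ->
  ind A M B -> ind (s @` A) M (s @` B).
Proof.
by move=> sA sM smA smB /(ind_inv sA smA M_small smB); rewrite (image_fixes sM).
Qed.

Lemma subst_forms (I P : Type) (phi : formula L (I + P)) (e : P -> U) (E : set U) :
  (forall p, E (e p)) -> forms_over E (subst phi e).
Proof.
move=> eE; pose e' p : {c | E c} := exist _ (e p) (eE p).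
exists (rename (glue inl (inr \o e')) phi) => //.
by rewrite /subst rename_rename; congr rename; apply: funext => -[].
Qed.

Lemma range_sval (N : set U) : range (sval : {c | N c} -> U) = N.
Proof.
apply/seteqP; split=> [_ [c _ <-]|c Nc]; first exact: svalP.
by exists (exist _ c Nc).
Qed.

(** [tp(N/MA)] is an heir exactly when [tp(A/N)] is a coheir. *)
Lemma ind_coheir (N : set U) (I : Type) (A : I -> U) :
  small K N -> M `<=` N -> Small I -> ind N M (range A) ->
  exists2 F : set_system (Mt I), UltraFilter F & real F N A.
Proof.
move=> sN MN sI NA; apply: coheir_ultra => // phi sphi.
have [c0] := elementary_inhabited M_elem.
have := @ind_heir _ (sval : {c | N c} -> U) (range A) (small_sig sN) (small_range A sI).
rewrite range_sval => /(_ NA) heirN.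
have [k [r [t supp]]] := finite_support phi.
pose b j : U := if t j is Some (inl i) then A i else sval c0.
pose chi : Mformula M {c | N c} 'I_k.+1 :=
  rename (glue (inr \o inl \o r \o inl) inl) phi.
have chiE (d : 'I_k.+1 -> U) : psat sval (inst chi d) <->
    sat phi (glue (d \o r \o inl) sval).
  rewrite psat_subst sat_rename.
  suff -> : glue sval (glue d (sval : {c | M c} -> U))
      \o glue (inr \o inl \o r \o inl) inl
    = glue (d \o r \o inl) sval :> (I + {c | N c} -> U) by [].
  by apply: funext => -[].
have [|m mM [_ /chiE h]] := heirN _ chi b.
  split; last first.
    by apply/chiE; apply: (supp _ _ _ _).1 sphi => -[i|//] /= tr; rewrite /b tr.
  apply: subst_forms => -[j|c] /=; last by left; apply: svalP.
  by rewrite /b; case: (t j) => [[i|_]|]; [right; exists i|left; apply: svalP|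
    left; apply: svalP].
by exists (fun i => exist _ (m (r (inl i))) (mM _)).
Qed.

Context {N : nat -> set U} (hN : saturating_chain N).

Let sN k : small K (N k). Proof. by case: hN. Qed.
Let NS k : N k `<=` N k.+1. Proof. by case: hN. Qed.
Let MN k : M `<=` N k.
Proof. by case: hN => _ M0 _ _ _; elim: k => // k IH c /IH/NS. Qed.
Let cN k : M_complete (N k).
Proof.
case: hN => _ _ _ c0 _; elim: k => // k IH n c; have [c' c'N e] := IH n c.
by exists c' => // j; apply/NS.
Qed.

Section Tree.
Context {m : nat} (F Q : set_system (Mt 'I_m)).
Context (uF : UltraFilter F) (uQ : UltraFilter Q).
Context (b : 'I_m -> U) (Nb : forall k, real F (N k) b /\ ind (N k) M (range b)).
Context (a0 : 'I_m -> U) (Fa0 : real F M a0) (Qa0 : real Q M a0).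

Let V := (seq bool * 'I_m)%type.
Let sV : Small V := small_tree m.

Definition indep_coheir (k : nat) (S : set_system (Mt V)) : Prop :=
  exists2 A, real S (N k) A & ind (N k) M (range A).

(** One copy of the tree is taken inside [N k.+1], from which the other copy is
    independent; strong right transitivity then makes [N k] independent from the
    pair.  Duplication costs one step of the chain. *)
Lemma indep_coheir_prod k S : UltraFilter S -> indep_coheir k.+1 S ->
  exists A A' : V -> U, [/\ real S (N k) A, real S (N k `|` range A) A' &
    ind (N k) M (range A `|` range A')].
Proof.
move=> uS [A' SA' iA']; have [_ _ _ _ /(_ k _ S uS)[A SA AN]] := hN.
have sA : small K (range A) by apply: small_range.
have sA' : small K (range A') by apply: small_range.
exists A, A'; split=> //.
  apply: (generic_mono (generic_real sV uS)) SA' => c [/NS//|/AN//].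
apply: ind_srt => //.
  by apply: ind_sub iA' => // c [/NS//|/AN//].
have SA'k : real S (N k) A' := generic_mono (generic_real sV uS) (@NS k) SA'.
have [s [sAut sfix <-]] := generic_uniq (generic_real sV uS) (@MN k) (sN k) SA'k SA.
rewrite -image_range -{1}(image_fixes sfix); apply: ind_aut => //.
  by move=> c /(@MN k) /sfix.
exact: ind_sub iA'.
Qed.

(** Contrary to [utower_all_heights], the type [F] of the nodes is prescribed.  The new
    root is taken on a coheir Morley sequence that starts at the pair of trees and
    whose roots are generated by [Q]: by the chain condition this sequence may be
    assumed indiscernible over [N k], so the next root on it has the same type [F]
    over [N k] as the root it starts from, while it realizes [Q] over both trees. *)
Lemma indep_tower h k : exists S, [/\ utower (real Q) F h S, indep_coheir k S &
  forall E B, M `<=` E -> real S E B -> real F E (node B [::])].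
Proof.
elim: h k => [|h IH] k.
  pose f (v : V) : 'I_m + {c | M c} := inl v.2.
  exists (fmap (Mt_map f) F); split; first by split=> //; apply: ultra_fmap.
    exists (glue b sval \o f); first exact: real_map (@MN k) (Nb k).1.
    apply: ind_sub (Nb k).2 => //; first exact: small_range (small_countable K_nat _).
    by move=> _ [v _ <-]; exists v.2.
  move=> E B ME SB; pose top (y : 'I_m) : V + {c | M c} := inl ([::], y).
  have := real_map top ME SB.
  by have -> : fmap (Mt_map top) (fmap (Mt_map f) F) = F by [].
have [S [tS gS rS]] := IH k.+1; have uS := utower_ultra tS.
have [A [A' [SA SA' iAA']]] := indep_coheir_prod uS gS.
pose Af := glue A A'; have sVV : Small (V + V) by apply: small_sum.
have SSA : real (prodF S S) (N k) Af := real_prodF (@MN k) SA SA'.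
pose e := node A [::].
have Fe : real F (N k) e := rS _ _ (@MN k) SA.
have gF := generic_real (small_countable K_nat _) uF.
have gQ := generic_real (small_countable K_nat _) uQ.
have Qe : real Q M e.
  have [s [sAut sM <-]] := generic_uniq gF (@subset_refl _ M) M_small Fa0
    (generic_mono gF (@MN k) Fe).
  by apply: (generic_aut gQ sAut sM _ Qa0); rewrite image_fixes.
(* a coheir Morley sequence starting at the pair of trees, along which the root of
   the first one is generated by [Q] *)
pose top (y : 'I_m) : (V + V) + {c | M c} := inl (inl ([::], y)).
have [R [uR RQ RAf]] := @coheir_lift 'I_m _ top Q Af uQ Qe.
have [s s0 sR] := morley_sequence sVV uR RAf.
have smAf : small K (range Af) by apply: small_range.
have range_Af : range Af = range A `|` range A'.
  apply/seteqP; split=> [_ [[v|v] _ <-]|c [[v _ <-]|[v _ <-]]];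
    by [left; exists v|right; exists v|exists (inl v)|exists (inr v)].
have iAf : ind (range (sval : {c | N k c} -> U)) M (range Af).
  by rewrite range_sval range_Af.
have morley : coheir_morley_in M Af s.
  exists (typ R); split; first exact: global_typ.
  - exact: tp_typ.
  - exact: coheir_typ.
  - by move=> i; apply/(gtype_typ _ _ uR)/sR.
have [a' [a'a ia' a'ind]] := ind_chain (small_sig (sN k)) sVV iAf morley s0.
have [t [tAut tfix ta']] := equiv_aut (small_sig (sN k))
  (small_setU K_nat K_lim M_small smAf) a'a.
have tM : fixes t M by move=> c Mc; apply: tfix; left.
have tAf : t \o Af = Af by apply: funext => v; apply: tfix; right; exists v.
pose e1 := t \o (glue (s 1) sval \o top).
have Fe1 : real F (N k) e1.
  move=> P phi d dN; rewrite -(Fe _ _ _ dN).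
  have [d' d'E] : exists d' : P -> {c | N k c}, d = t \o (a' \o d').
    exists (fun p => exist _ (d p) (dN p)); apply: funext => p.
    by have := congr1 (@^~ (exist _ (d p) (dN p))) ta' => /= ->.
  have dE (z : 'I_m -> U) : glue (t \o z) d = t \o glue z (a' \o d').
    by rewrite d'E; apply: funext => -[].
  have -> : e = t \o e.
    by apply: funext => y; have := congr1 (@^~ (inl ([::], y))) tAf => /= ->.
  rewrite !dE !(sat_aut _ _ tAut).
  pose chi : formula L ('I_1 * (V + V) + P) :=
    rename (glue (fun y => inl (ord0, inl ([::], y))) inr) phi.
  have E0 i : glue (fun ki : 'I_1 * (V + V) => s i ki.2) (a' \o d')
      \o glue (fun y => inl (ord0, inl ([::], y))) inr
      = glue (glue (s i) sval \o top) (a' \o d') :> ('I_m + P -> U).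
    by apply: funext => -[].
  have h1 (i j : 'I_1) : (i < j)%N -> (0 < 0)%N by rewrite !ord1.
  have h2 (i j : 'I_1) : (i < j)%N -> (1 < 1)%N by rewrite !ord1.
  have /equivP/(_ _ chi (a' \o d')) := a'ind 1 (fun=> 0) (fun=> 1) h1 h2.
  rewrite /chi !sat_rename !E0 s0 => -> // p; right; by exists (d' p).
have Qe1 : real Q (M `|` range Af) e1.
  have s1R : real R (M `|` range Af) (s 1).
    apply: (generic_mono (generic_real sVV uR)) (sR 1) => c [Mc|Ac]; first by left.
    by right; exists 0; rewrite //= s0.
  have ME : M `<=` M `|` range Af by move=> c; left.
  have := real_map top ME s1R; rewrite RQ => Qs1.
  by apply: (generic_aut gQ tAut tM _ Qs1); rewrite (image_fixes tfix).
have ie1 : ind (N k) M (range Af `|` range e1).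
  have smU : small K (\bigcup_i range (s i)).
    apply: (@small_sub _ _ _ (range (fun p : nat * (V + V) => s p.1 p.2))).
      by move=> _ [j _ [v _ <-]]; exists (j, v).
    by apply: small_range; apply: small_prod.
  have := ind_aut tAut tM (small_range a' (small_sig (sN k))) smU ia'.
  rewrite image_range ta' range_sval; apply: ind_sub => //.
    exact: small_image.
  move=> c [[v _ <-]|[y _ <-]].
    exists (s 0 v); first by exists 0 => //; exists v.
    by rewrite s0; have := congr1 (@^~ v) tAf.
  by exists (s 1 (inl ([::], y))) => //; exists 1 => //; eexists.
pose A2 (v : V) : U := match v.1 with
  | [::] => e1 v.2
  | false :: eta => A (eta, v.2)
  | true :: eta => A' (eta, v.2)
  end.
have iA2 : ind (N k) M (range A2).
  apply: ind_sub ie1 => //.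
    apply: small_setU => //; apply: small_range; exact: small_countable.
  move=> _ [[[|[] eta] y] _ <-]; [by right; exists y|left..].
    by exists (inr (eta, y)).
  by exists (inl (eta, y)).
have [S' uS' S'A2] := ind_coheir (sN k) (@MN k) sV iA2.
pose cones (v : V + V) : V + {c | M c} := match v with
  | inl v => inl (false :: v.1, v.2) | inr v => inl (true :: v.1, v.2) end.
pose root (y : 'I_m) : V + {c | M c} := inl ([::], y).
have conesE (B : V -> U) :
    glue B sval \o cones = glue (cone [:: false] B) (cone [:: true] B).
  by apply: funext => -[].
have A2_cones : glue A2 sval \o cones = Af.
  by apply: funext => -[[eta y]|[eta y]].
have rS' E B : M `<=` E -> real S' E B -> real F E (node B [::]).
  move=> ME S'B; apply: (real_determined (@cN k) _ Fe1 (real_map root ME S'B)).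
  exact: (real_map root (@MN k) S'A2).
exists S'; split=> //; last by exists A2.
split=> //; exists S; split=> //.
- move=> E B ME S'B.
  have : real (prodF S S) E (glue (cone [:: false] B) (cone [:: true] B)).
    rewrite -conesE; apply: (real_determined (@cN k) _ SSA (real_map cones ME S'B)).
    by rewrite -A2_cones; apply: (real_map cones (@MN k) S'A2).
  by move=> /(prodF_real uS uS ME)[S0 S1]; split=> //; exact: rS'.
- move=> B S'B.
  have [s1 [s1Aut s1M s1B]] := generic_uniq (generic_real sV uS') (@subset_refl _ M)
    M_small (generic_mono (generic_real sV uS') (@MN k) S'A2) S'B.
  have -> : node B [::] = s1 \o e1 by rewrite -s1B.
  apply: (generic_aut gQ s1Aut s1M _ Qe1) => c [Mc|].
    by exists c; [left|apply: s1M].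
  rewrite -s1B => -[] [[eta y] _ <-]; rewrite /cone /=.
    by exists (A (eta, y)) => //; right; exists (inl (eta, y)).
  by exists (A' (eta, y)) => //; right; exists (inr (eta, y)).
Qed.

End Tree.

Lemma unsat_fmap (n m : nat) (J : Type) (phi : Mformula M 'I_n J)
    (f : 'I_m -> J + {c | M c}) (psi : formula L ('I_n + 'I_m)) k
    (F : set_system (Mt J)) :
  (forall (x : 'I_n -> U) (a : J -> U),
     psat x (inst phi a) <-> sat psi (glue x (glue a sval \o f))) ->
  Small J -> UltraFilter F ->
  unsat psi k (real (fmap (Mt_map f) F)) <-> unsat_along phi k (real F).
Proof.
move=> phiE sJ uF; have gF := generic_real sJ uF.
have push E a : M `<=` E -> pushG f (real F) E a -> real (fmap (Mt_map f) F) E a.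
  by move=> ME [a' Fa' ->]; apply: real_map.
rewrite -(unsat_alongE sJ phiE k gF); split=> un l gl.
  by apply: un; apply: gens_impl gl.
have [l' gl'] := gens_ex (small_countable K_nat _)
  (all_nseq k (generic_reindex f sJ gF)) (@subset_refl _ M) M_small.
apply: (unsat_some (l := l') (generic_real (small_countable K_nat _)
  (ultra_fmap (Mt_map f) uF))) gl; last exact: un.
by apply: gens_impl gl'.
Qed.

(** The type over the union of the chain of a copy of [b] from which the chain is
    independent is a coheir [P].  If [phi] were satisfiable along [P] and not along a
    coheir [Q] of [b], trees with nodes of type [P] and branches generated by [Q]
    would contradict NATP. *)
Lemma ind_witness (J : Type) (b : J -> U) :
  NATP U -> small K (\bigcup_k N k) -> Small J ->
  exists P : set_system (Mt J), [/\ UltraFilter P, real P M b &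
    forall n (phi : Mformula M 'I_n J), kim_divides phi b ->
      exists k, unsat_along phi k (real P)].
Proof.
move=> natp sNN sJ; set NN := \bigcup_k N k in sNN.
have NNk k : N k `<=` NN by move=> c Nc; exists k.
have MNN : M `<=` NN by move=> c /(@MN 0); apply: NNk.
have smB : small K (range b `|` M) by apply: small_setU => //; apply: small_range.
have [a' a'a ia'] := ind_full (sval : {c | NN c} -> U) (small_sig sNN) smB.
have [t [tAut tM ta']] := equiv_aut (small_sig sNN) M_small a'a.
pose b1 := t \o b.
have ib1 : ind NN M (range b1 `|` M).
  have := ind_aut tAut tM (small_range a' (small_sig sNN)) smB ia'.
  by rewrite image_range ta' range_sval image_setU image_range (image_fixes tM).
have smB1 : small K (range b1 `|` M) by apply: small_setU => //; apply: small_range.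
have [|P uP Pb1] := ind_coheir sNN MNN sJ (A := b1).
  by apply: ind_sub ib1 => // c; left.
have [t' [t'Aut tK t'K]] := automorphism_inv tAut.
have t'M : fixes t' M by move=> c Mc; rewrite -{1}(tM c Mc) tK.
have Pb : real P M b.
  have -> : b = t' \o b1 by apply: funext => j; rewrite /b1 /= tK.
  apply: (generic_aut (generic_real sJ uP) t'Aut t'M _ Pb1) => c Mc.
  by exists c; [apply: MNN|apply: t'M].
exists P; split=> // n phi /(kim_divides_coheir natp sJ)[Q [uQ Qb [k unQ]]].
have Qb1 : real Q M b1.
  apply: (generic_aut (generic_real sJ uQ) tAut tM _ Qb); by rewrite image_fixes.
have [m [f [psi phiE]]] := finite_formula phi.
have uPf : UltraFilter (fmap (Mt_map f) P) by apply: ultra_fmap.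
have uQf : UltraFilter (fmap (Mt_map f) Q) by apply: ultra_fmap.
apply: contrapT => nP.
apply: (no_utowers (generic_real (small_countable K_nat _) uQf) natp uPf
  ((unsat_fmap _ phiE sJ uQ).2 unQ)) => [j /(unsat_fmap _ phiE sJ uP) unj|h].
  by apply: nP; exists j.
have Pk k' : real P (N k') b1 := generic_mono (generic_real sJ uP) (@NNk k') Pb1.
have [|S [tS _ _]] := indep_tower uPf uQf (b := glue b1 sval \o f) _
  (real_map f (@subset_refl _ M) (generic_mono (generic_real sJ uP) MNN Pb1))
  (real_map f (@subset_refl _ M) Qb1) h 0; last by exists S.
move=> k'; split; first exact: real_map (@MN k') (Pk k').
apply: ind_sub ib1 => // _ [j _ <-] /=; case: (f j) => [i|c] /=.
  by left; exists i.
by right; apply: svalP.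
Qed.

End Independence.

(** * Witnesses of Kim-dividing *)

Lemma generic_indiscernible (I : Type) (G : set U -> (I -> U) -> Prop) s :
  Small I -> generic G ->
  (forall i, G (M `|` \bigcup_(j in [set j | (j < i)%N]) range (s j)) (s i)) ->
  indiscernible M s.
Proof.
move=> sI gG sG n f g fI gI.
pose ext (f : 'I_n -> nat) i := oapp f 0 (insub i : option 'I_n).
have extI (h : 'I_n -> nat) : (forall k l : 'I_n, (k < l)%N -> (h k < h l)%N) ->
    forall i j, (i < j < n)%N -> (ext h i < ext h j)%N.
  move=> hI i j /andP[ij jn]; have i_n := ltn_trans ij jn.
  rewrite /ext (insubT (fun k => k < n)%N i_n) (insubT (fun k => k < n)%N jn).
  exact: hI.
have gl h hI := generated_generic (fun E E' a => @generic_mono _ G E E' a gG) sG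
  (extI h hI).
have [s1 [s1Aut s1M E]] := gens_uniq sI (all_nseq n gG) (@subset_refl _ M) M_small
  (gl f fI) (gl g gI).
have -> : (fun ki : 'I_n * I => s (g ki.1) ki.2)
    = s1 \o (fun ki : 'I_n * I => s (f ki.1) ki.2).
  apply: funext => -[k i] /=; have := congr1 (fun l => nth (s 0) l k i) E.
  rewrite (nth_map (s 0)) ?size_map ?size_iota // !(nth_map 0) ?size_iota //.
  by rewrite !nth_iota // !add0n /ext !valK /= => ->.
exact: aut_equiv.
Qed.

Lemma psat_aut (n : nat) (J : Type) (phi : Mformula M 'I_n J) s (x : 'I_n -> U) a :
  automorphism s -> fixes s M ->
  psat (s \o x) (inst phi (s \o a)) <-> psat x (inst phi a).
Proof.
move=> sA sM; rewrite !psat_subst -(sat_aut _ (glue x (glue a sval)) sA).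
suff -> : s \o glue x (glue a (sval : {c | M c} -> U))
    = glue (s \o x) (glue (s \o a) sval) by [].
by apply: funext => -[|[|c]] //=; apply: sM; apply: svalP.
Qed.

Definition Mrename (n : nat) (I J : Type) (g : I -> J) (phi : Mformula M 'I_n I) :
    Mformula M 'I_n J :=
  rename (glue inl (inr \o glue (inl \o g) inr)) phi.

Lemma psat_Mrename n (I J : Type) (g : I -> J) (phi : Mformula M 'I_n I)
    (x : 'I_n -> U) a :
  psat x (inst (Mrename g phi) a) <-> psat x (inst phi (a \o g)).
Proof.
rewrite !psat_subst sat_rename; suff -> : glue x (glue a (sval : {c | M c} -> U))
    \o glue inl (inr \o glue (inl \o g) inr)
  = glue x (glue (a \o g) sval) :> ('I_n + (I + {c | M c}) -> U) by [].
by apply: funext => -[|[]].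
Qed.

(** An invariant type of a subtuple need not extend to one of the whole tuple, but
    a coheir does. *)
Lemma kim_divides_rename n (I J : Type) (g : I -> J) (phi : Mformula M 'I_n I) b :
  NATP U -> Small I -> Small J -> kim_divides phi (b \o g) ->
  kim_divides (Mrename g phi) b.
Proof.
move=> natp sI sJ /(kim_divides_coheir natp sI)[F [uF Fb [k un]]].
have [m [f [psi phiE]]] := finite_formula phi.
pose f' (y : 'I_m) : J + {c | M c} :=
  match f y with inl i => inl (g i) | inr c => inr c end.
have f'E (a : J -> U) : glue a sval \o f' = glue (a \o g) sval \o f.
  by apply: funext => y; rewrite /= /f'; case: (f y).
have F0b := real_map f (@subset_refl _ M) Fb; rewrite -f'E in F0b.
have [F' [uF' F'F F'b]] := coheir_lift (ultra_fmap (Mt_map f) uF) F0b.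
apply: (kim_divides_along (k := k) sJ uF' F'b).
apply/(unsat_fmap (f := f') (psi := psi) _ _ sJ uF').
  by move=> x a; rewrite psat_Mrename phiE f'E.
by rewrite F'F; apply/(unsat_fmap _ phiE sI uF).
Qed.

Lemma gens_all (I : Type) (G : set U -> (I -> U) -> Prop) k l E :
  generic G -> M `<=` E -> gens E (nseq k G) l -> Alls (G M) l.
Proof.
move=> gG; elim: k l E => [|k IH] [|a l] //= E ME [Ga gl]; split.
  exact: generic_mono gG ME Ga.
by apply: IH gl => c /ME; left.
Qed.

Lemma pigeonhole (A : Type) (k : nat) (P : 'I_k -> A -> Prop) (w : 'I_k -> nat) l :
  (\sum_j w j < size l)%N -> Alls (fun a => exists j, P j a) l ->
  exists j (bs : bitseq), [/\ (w j <= size (mask bs l))%N, size bs = size l &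
    Alls (P j) (mask bs l)].
Proof.
move=> wl lP; have [b lb] : exists b : seq (A * 'I_k),
    map fst b = l /\ Alls (fun p => P p.2 p.1) b.
  elim: l lP {wl} => [|a l IH] /=; first by exists [::].
  by move=> [[j Pj] /IH[b [<- bP]]]; exists ((a, j) :: b).
have [bl bP] := lb; pose cnt j := count (fun p : A * 'I_k => p.2 == j) b.
have sum_cnt : (\sum_j cnt j = size l)%N.
  rewrite -bl /cnt; elim: (b) => [|p b' IH] /=; first by rewrite big1.
  rewrite big_split /= IH size_map -add1n; congr addn.
  by rewrite (bigD1 p.2) //= eqxx big1 // => j /negPf; rewrite eq_sym => ->.
have [j wj] : exists j, (w j <= cnt j)%N.
  apply: contrapT => /forallNP h; move: wl; rewrite -sum_cnt ltnNge => /negP; apply.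
  by apply: leq_sum => j _; apply/ltnW; rewrite ltnNge; apply/negP/h.
exists j, [seq p.2 == j | p <- b]; rewrite -bl !size_map; split=> //.
  rewrite size_mask ?size_map // count_map; exact: wj.
elim: (b) bP => //= p b' IH [Pp /IH]; case: eqP => //= <- h; by split.
Qed.

Lemma gens_mask_nseq (I : Type) (G : set U -> (I -> U) -> Prop) k l (bs : bitseq) :
  generic G -> gens M (nseq k G) l -> size bs = size l ->
  gens M (nseq (size (mask bs l)) G) (mask bs l).
Proof.
move=> gG gl sbs; have := gens_mask bs (all_nseq k gG) gl.
have kl : k = size l by rewrite -(gens_size gl) size_nseq.
suff -> : mask bs (nseq k G) = nseq (size (mask bs l)) G by [].
by rewrite kl; elim: l bs sbs {gl kl} => [|a l IH] [|[] bs] //= [/IH ->].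
Qed.

(** If [phi(x, a)] implies a disjunction of Kim-dividing formulas, a witness for
    the tuple of all parameters makes all the disjuncts inconsistent along the
    same sequences, hence also [phi(x, a)], by the pigeonhole principle. *)
Lemma forks_divides (n : nat) (J : Type) (phi : Mformula M 'I_n J) (a : J -> U) :
  NATP U ->
  (forall (I : Type) (b : I -> U), Small I ->
     exists P : set_system (Mt I), [/\ UltraFilter P, real P M b &
       forall n (phi : Mformula M 'I_n I), kim_divides phi b ->
         exists k, unsat_along phi k (real P)]) ->
  Small J -> kim_forks K phi a -> kim_divides phi a.
Proof.
move=> natp wit sJ [k [H [psi [c [sH psidiv phipsi]]]]].
pose I := (J + {j & H j})%type.
have sI : Small I by apply: small_sum => //; apply: small_sigma_ord.
pose b : I -> U := glue a (fun p => c (projT1 p) (projT2 p)).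
pose g j (h : H j) : I := inr (existT _ j h).
have [P [uP Pb Pdiv]] := wit I b sI.
have gP := generic_real sI uP.
have psi_un j : exists w, unsat_along (Mrename (@g j) (psi j)) w (real P).
  apply: Pdiv; apply: kim_divides_rename => //; exact: psidiv.
have [w wP] := choice psi_un.
(* more than [\sum_j w j] tuples, each giving one of the disjuncts, give the [j]-th
   one at [w j] tuples for some [j] *)
have phi_un : unsat_along (Mrename inl phi) (\sum_j w j).+1 (real P).
  move=> l gl [x xl].
  have lcol : Alls (fun d => exists j, psat x (inst (Mrename (@g j) (psi j)) d)) l.
    elim: l xl {gl} (gens_all gP (@subset_refl _ M) gl) => //= d l IH [xd xl] [Pd Pl].
    split; last exact: IH.
    have [s [sA sM sbd]] := generic_uniq gP (@subset_refl _ M) M_small Pb Pd.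
    have [s' [_ sK s'K]] := automorphism_inv sA.
    have xE : x = s \o (s' \o x) by apply: funext => i; rewrite /= s'K.
    move: xd; rewrite -sbd xE psat_aut // psat_Mrename => /phipsi[j xj].
    by exists j; rewrite psat_aut // psat_Mrename.
  have [|j [bs [wj sbs bP]]] := pigeonhole (w := w) _ lcol.
    by rewrite -(gens_size gl) size_nseq.
  have := gens_take (w j) (gens_mask_nseq gP gl sbs).
  by rewrite take_nseq // => /wP; apply; exists x; apply: Alls_take.
pose q (i : J) : I + {c | M c} := inl (inl i).
have uPa : UltraFilter (fmap (Mt_map q) P) by apply: ultra_fmap.
have Pa : real (fmap (Mt_map q) P) M a := real_map q (@subset_refl _ M) Pb.
apply: (kim_divides_along sJ uPa Pa).
have [l gl] := gens_ex sI (all_nseq (\sum_j w j).+1 gP) (@subset_refl _ M) M_small.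
apply: (unsat_along_some (l := [seq glue d sval \o q | d <- l]) sJ
  (generic_real sJ uPa)).
  apply: (gens_impl (G := pushG q (real P))) => //.
    by move=> E _ ME [d Pd ->]; apply: real_map.
  exact: (gens_push q sI gP (@subset_refl _ M) gl).
move=> [x /Alls_map xl]; apply: (phi_un _ gl); exists x.
by apply: Alls_impl xl => d xd; rewrite psat_Mrename.
Qed.

End OverM.
End Monster.

Theorem proposition4p8 (L : language) (T : theory L) (K : Type)
    (U : structure L) (M : set U)
    (hT : complete_theory T) (hU : monster_model K T U)
    (hN : NATP U) (hM : small_model K M) :
  (exists ind : ternary_relation U,
     pre_independence K ind /\
     stronger_than_heir K M ind /\
     monotonicity K M ind /\
     full_existence K M ind /\
     right_chain_condition K M ind /\
     strong_right_transitivity K M ind) ->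
  (forall (J : Type) (b : J -> U), small K [set: J] ->
     exists p : set (pformula J),
       global_type p /\ coheir M p /\ tp b M `<=` p /\ witness_type M b p) /\
  (forall (n : nat) (J : Type) (phi : Mformula M 'I_n J) (a : J -> U),
     small K [set: J] ->
     (kim_forks K phi a <-> kim_divides phi a)).
Proof.
move=> [ind [i1 [i2 [i3 [i4 [i5 i6]]]]]].
have [N chainN sNN] := saturating_chain_ex hU hM.
have wit (J : Type) (b : J -> U) (sJ : small K [set: J]) :=
  ind_witness hU hM i1 i2 i3 i4 i5 i6 chainN b hN sNN sJ.
split=> [J b sJ|n J phi a sJ].
  have [P [uP Pb Pdiv]] := wit J b sJ.
  exists (typ P); split; first exact: global_typ.
  split; first exact: coheir_typ.
  split; first exact: tp_typ.
  split; [exact: global_typ|exact: invariant_typ|exact: tp_typ|].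
  move=> s s0 sP.
  have gP := generic_real hU sJ uP.
  have sP' i : real P (M `|` \bigcup_(j in [set j | (j < i)%N]) range (s j)) (s i).
    exact/(gtype_typ _ _ uP)/sP.
  split=> //; first exact: (generic_indiscernible hU hM sJ gP sP').
  move=> n phi /Pdiv un; apply/(generated_unsat hU hM phi sJ gP _ sP') => //.
  move=> E E' c; exact: (generic_mono gP).
split; first exact: (forks_divides hU hM hN wit sJ).
move=> div; exists 1, (fun=> J), (fun=> phi), (fun=> a); split=> // x xphi.
by exists ord0.
Qed.
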